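(* Let $\Lambda$ be a linear order. There is a $\Lambda$-effective procedure which decides, for any closed formula $\phi$ (built from $\top$ using $\neg,\wedge$ and modalities $[\alpha]$ with $\alpha\in|\Lambda|$), whether $\mathsf{GLP}^0_\Lambda\vdash\phi$.
   Context: $\mathsf{GLP}_\Lambda$ (for a linear order $\Lambda$) is the modal logic in the language with modalities $[\alpha]$, $\alpha\in|\Lambda|$, $\langle\alpha\rangle:=\neg[\alpha]\neg$, axiomatized by propositional tautologies and, for all $\alpha,\beta\in|\Lambda|$: (i) $[\alpha](\chi\to\psi)\to([\alpha]\chi\to[\alpha]\psi)$; (ii) $[\alpha]([\alpha]\chi\to\chi)\to[\alpha]\chi$; (iii) $[\alpha]\chi\to[\beta][\alpha]\chi$ for $\alpha\le\beta$; (iv) $\langle\alpha\rangle\chi\to[\beta]\langle\alpha\rangle\chi$ for $\alpha<\beta$; (v) $[\alpha]\chi\to[\beta]\chi$ for $\alpha\le\beta$; with rules modus ponens and necessitation for each $[\alpha]$. A closed formula is one without propositional variables; $\mathsf{GLP}^0_\Lambda$ is the set of closed formulas provable in $\mathsf{GLP}_\Lambda$. A procedure is $\Lambda$-effective if it is effective using an oracle deciding $\alpha<\beta$ for $\alpha,\beta\in|\Lambda|$. *)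

(* Defs.v *)
From mathcomp Require Import all_boot all_order.

Set Implicit Arguments.
Unset Strict Implicit.
Unset Printing Implicit Defensive.

Inductive form (L : Type) : Type :=
  | Var of nat
  | Top
  | Neg of form L
  | And of form L & form L
  | Box of L & form L.

Arguments Var {L}.
Arguments Top {L}.

Definition Imp (L : Type) (f g : form L) : form L := Neg (And f (Neg g)).
Definition Dia (L : Type) (a : L) (f : form L) : form L := Neg (Box a (Neg f)).

Fixpoint closed_form (L : Type) (f : form L) : bool :=
  match f with
  | Var _ => false
  | Top => true
  | Neg f1 => closed_form f1
  | And f1 f2 => closed_form f1 && closed_form f2
  | Box _ f1 => closed_form f1
  end.

(* Variables and boxed formulas are the propositional atoms, so that the
   tautologies below are all modal substitution instances of tautologies. *)
Fixpoint peval (L : Type) (v : form L -> bool) (f : form L) : bool :=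
  match f with
  | Var _ | Box _ _ => v f
  | Top => true
  | Neg f1 => ~~ peval v f1
  | And f1 f2 => peval v f1 && peval v f2
  end.

Definition tautology (L : Type) (f : form L) : Prop :=
  forall v : form L -> bool, peval v f.

Inductive GLP (d : Order.disp_t) (L : orderType d) : form L -> Prop :=
  | GLP_taut f : tautology f -> GLP f
  | GLP_K a f g : GLP (Imp (Box a (Imp f g)) (Imp (Box a f) (Box a g)))
  | GLP_Loeb a f : GLP (Imp (Box a (Imp (Box a f) f)) (Box a f))
  | GLP_box a b f : (a <= b)%O -> GLP (Imp (Box a f) (Box b (Box a f)))
  | GLP_dia a b f : (a < b)%O -> GLP (Imp (Dia a f) (Box b (Dia a f)))
  | GLP_mono a b f : (a <= b)%O -> GLP (Imp (Box a f) (Box b f))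
  | GLP_MP f g : GLP (Imp f g) -> GLP f -> GLP g
  | GLP_nec a f : GLP f -> GLP (Box a f).

Definition GLP0 (d : Order.disp_t) (L : orderType d) (f : form L) : Prop :=
  closed_form f /\ GLP f.

(* Relative computability over a carrier A of any cardinality: McCarthy-style
   recursive programs on S-expressions whose atoms are the elements of A.
   Programs contain no elements of A, and can inspect atoms only through the
   oracle r. *)
Inductive sexp (A : Type) : Type :=
  | Nil
  | Atom of A
  | Cons of sexp A & sexp A.

Arguments Nil {A}.

Inductive exp : Type :=
  | EArg                          (* the argument of the current function *)
  | ENil
  | ECons of exp & exp
  | EHd of exp
  | ETl of exp
  | EIsCons of exp
  | EIsAtom of exp
  | EOracle of exp & exp          (* oracle query on two atoms *)
  | EIf of exp & exp & exp        (* Nil is false, everything else is true *)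
  | ECall of nat & exp.           (* call of the i-th function, by value *)

(* The i-th entry is the body of the i-th unary function; the functions may call
   each other recursively, and function 0 is the entry point. *)
Definition program := seq exp.

Definition of_bool (A : Type) (b : bool) : sexp A :=
  if b then Cons Nil Nil else Nil.

Definition hd (A : Type) (s : sexp A) : sexp A :=
  if s is Cons s1 _ then s1 else Nil.

Definition tl (A : Type) (s : sexp A) : sexp A :=
  if s is Cons _ s2 then s2 else Nil.

Definition is_nil (A : Type) (s : sexp A) : bool :=
  if s is Nil then true else false.

Definition is_cons (A : Type) (s : sexp A) : bool :=
  if s is Cons _ _ then true else false.

Definition is_atom (A : Type) (s : sexp A) : bool :=
  if s is Atom _ then true else false.

Definition query (A : Type) (r : rel A) (s t : sexp A) : bool :=
  match s, t with Atom a, Atom b => r a b | _, _ => false end.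

(* [run r P x e y]: under program P with oracle r, the expression e terminates
   with value y when the argument of the current function is x. *)
Inductive run (A : Type) (r : rel A) (P : program) (x : sexp A) :
    exp -> sexp A -> Prop :=
  | run_arg : run r P x EArg x
  | run_nil : run r P x ENil Nil
  | run_cons e1 e2 y1 y2 : run r P x e1 y1 -> run r P x e2 y2 ->
      run r P x (ECons e1 e2) (Cons y1 y2)
  | run_hd e y : run r P x e y -> run r P x (EHd e) (hd y)
  | run_tl e y : run r P x e y -> run r P x (ETl e) (tl y)
  | run_is_cons e y : run r P x e y ->
      run r P x (EIsCons e) (of_bool A (is_cons y))
  | run_is_atom e y : run r P x e y ->
      run r P x (EIsAtom e) (of_bool A (is_atom y))
  | run_oracle e1 e2 y1 y2 : run r P x e1 y1 -> run r P x e2 y2 ->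
      run r P x (EOracle e1 e2) (of_bool A (query r y1 y2))
  | run_if e e1 e2 y z : run r P x e y ->
      run r P x (if is_nil y then e2 else e1) z -> run r P x (EIf e e1 e2) z
  | run_call i e y z : run r P x e y -> run r P y (nth ENil P i) z ->
      run r P x (ECall i e) z.

Definition computes (A : Type) (r : rel A) (P : program) (x y : sexp A) : Prop :=
  run r P x (nth ENil P 0) y.

Lemma run_det (A : Type) (r : rel A) (P : program) (x : sexp A) (e : exp)
    (y z : sexp A) : run r P x e y -> run r P x e z -> y = z.
Proof.
move=> h; elim: h z => {x e y}.
- by move=> x z h; inversion h.
- by move=> x z h; inversion h.
- move=> x e1 e2 y1 y2 _ IH1 _ IH2 z h; inversion h; subst.
  by congr Cons; [apply: IH1 | apply: IH2].
- by move=> x e y _ IH z h; inversion h; subst; congr hd; apply: IH.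
- by move=> x e y _ IH z h; inversion h; subst; congr tl; apply: IH.
- by move=> x e y _ IH z h; inversion h; subst; rewrite (IH _ H0).
- by move=> x e y _ IH z h; inversion h; subst; rewrite (IH _ H0).
- move=> x e1 e2 y1 y2 _ IH1 _ IH2 z h; inversion h; subst.
  by rewrite (IH1 _ H1) (IH2 _ H3).
- move=> x e e1 e2 y y' _ IH1 _ IH2 z h; inversion h; subst.
  by apply: IH2; rewrite (IH1 _ H3).
- move=> x i e y y' _ IH1 _ IH2 z h; inversion h; subst.
  by apply: IH2; rewrite (IH1 _ H1).
Qed.

Fixpoint numeral (A : Type) (n : nat) : sexp A :=
  if n is m.+1 then Cons Nil (numeral A m) else Nil.

(* The syntax tree of a formula, with a numeral at each node as tag; the
   modality indices occur in it as atoms. *)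
Fixpoint encode (L : Type) (f : form L) : sexp L :=
  match f with
  | Top => Cons (numeral L 0) Nil
  | Neg f1 => Cons (numeral L 1) (encode f1)
  | And f1 f2 => Cons (numeral L 2) (Cons (encode f1) (encode f2))
  | Box a f1 => Cons (numeral L 3) (Cons (Atom a) (encode f1))
  | Var n => Cons (numeral L 4) (numeral L n)
  end.

(* P, given an oracle for the strict order of L, halts on every formula in D and
   tells whether it belongs to S. *)
Definition effectively_decides (d : Order.disp_t) (L : orderType d)
    (P : program) (D S : form L -> Prop) : Prop :=
  forall f : form L, D f ->
    exists b : bool,
      computes (fun a c : L => (a < c)%O) P (encode f) (of_bool L b) /\
      (b <-> S f).

(* Main.v *)
Require Import Defs.
From mathcomp Require Import all_boot all_order.
From HB Require Import structures.
From mathcomp Require Import boolp zify.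

(** Every closed formula is effectively equivalent to a disjunction of formulas
    [A /\ ~ B_1 /\ ... /\ ~ B_k], where [A] and the [B_i] are worms, that is,
    iterated consistency statements [<a_1>...<a_n>T].  Two worms are linearly
    ordered by "[A] proves [<c>B]", [c] being their least letter: splitting
    both at the first occurrence of [c], as [A = A1 c A2] and [B = B1 c B2],
    reduces a comparison to smaller ones, since [A] is equivalent to
    [A1 /\ <c>A2].  Hence conjunctions of worms are worms, implication between
    worms is decidable, and by Loeb's theorem a disjunct is refutable exactly
    when [A] proves some [B_i], provided that no worm is refutable.  The latter
    is shown on Icard's ordinal model: for finitely many modalities
    [a_1 < ... < a_n], take the tower [omega^(omega^(...))] of height [n]; the
    lowest modality quantifies over smaller ordinals and the higher ones are
    evaluated at the last exponent of the Cantor normal form.  Only formulas,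
    not arbitrary sets of points, behave well there, whence the notion of
    regular set. *)

Set Implicit Arguments.
Unset Strict Implicit.
Unset Printing Implicit Defensive.

(* Restores [Nil] and [Cons] of [sexp], hidden by those of [seq]. *)
Import Order.TTheory Defs.

(** * Powers of omega *)

Section OmegaPower.
Context {d : Order.disp_t} (T : orderType d).

Definition desc (l : seq T) : bool := sorted (fun x y : T => y <= x)%O l.

(** Cantor normal forms: a list [x1 >= x2 >= ...] stands for [omega^x1 + omega^x2 + ...], and the
    lexicographic order on such lists is the order of these ordinals. *)
Record opow := Opow { oval : seqlexi_with d T; _ : desc oval }.

HB.instance Definition _ := [isSub for oval].
HB.instance Definition _ := [Choice of opow by <:].
HB.instance Definition _ := [SubChoice_isSubOrder of opow by <: with d].

Lemma opow_ltE (x y : opow) : (x < y)%O = (oval x < oval y)%O.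
Proof. by []. Qed.

Lemma desc_cons (x : T) l : desc (x :: l) = (head x l <= x)%O && desc l.
Proof. by case: l => [|y l] //=; rewrite lexx. Qed.

Lemma desc_tail (x : T) l : desc (x :: l) -> desc l.
Proof. by rewrite desc_cons => /andP[]. Qed.

Lemma opow_wf : well_founded (fun x y : T => (x < y)%O) ->
  well_founded (fun x y : opow => (x < y)%O).
Proof.
move=> wfT; pose A := Acc (fun x y : opow => (x < y)%O).
have acc0 l (dl : desc l) : l = [::] -> A (Opow dl).
  by move=> l0; constructor=> -[m dm]; rewrite opow_ltE /= l0 ltxis0.
have accH (z : T) : forall l (dl : desc l), (head z l <= z)%O -> A (Opow dl).
  elim/(well_founded_induction wfT): z => z IHz.
  (* A nonempty list below [z :: l] either has its head below [z], where [IHz] applies, or is [z]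
     followed by a list below [l], which the induction on the accessibility of [l] covers. *)
  have accz (l : opow) : A l -> forall dl : desc (z :: oval l), A (Opow dl).
    elim=> {}l _ IHl dl; constructor=> -[[|y m] dm]; first by move=> _; apply: acc0.
    rewrite opow_ltE /= ltxi_cons => /andP[le_yz lt_ml].
    have [lt_yz|le_zy] := ltP y z; first exact: (IHz y).
    have ezy : y = z by apply/eqP; rewrite eq_le le_yz.
    rewrite {}ezy in dm lt_ml *; have dm' := desc_tail dm.
    by apply: (IHl (Opow dm')); rewrite opow_ltE /= (implyP lt_ml).
  elim=> [|y l IHl] dl /= le_yz; first exact: acc0.
  have [lt_yz|le_zy] := ltP y z; first exact: (IHz y).
  have ezy : y = z by apply/eqP; rewrite eq_le le_yz.
  rewrite {}ezy in dl *; have dl' := desc_tail dl.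
  apply: (accz (Opow dl')); apply: IHl.
  by move: dl; rewrite desc_cons => /andP[].
move=> [[|z l] dl]; first exact: acc0.
by apply: (accH z) => /=.
Qed.

Lemma head_lexi_le (x0 : T) (l m : seqlexi_with d T) : (l <= m)%O ->
  (head x0 m <= x0)%O -> (head x0 l <= x0)%O.
Proof.
case: l => [|y l]; case: m => [|z m] //=.
by rewrite lexi_cons => /andP[le_yz _]; apply: le_trans.
Qed.

(** [y] keeps the exponents of [c] that are at least [z] and then puts one [z]. The last clause lets
    [y] inherit every common upper bound of [z] and the head of [c]. *)
Lemma desc_insert (z : T) (c : seqlexi_with d T) : desc c ->
  exists y : seqlexi_with d T,
    [/\ desc y, (c < y)%O, last z y = z &
      forall u : T, z <= u -> head z c <= u -> head z y <= u]%O.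
Proof.
elim: c => [|v c IH] dc; first by exists [:: z]; rewrite ltxi0s.
have [le_zv|lt_vz] := leP z v; last first.
  exists [:: z]; split=> //; rewrite ltxi_cons (ltW lt_vz) /=.
  by apply/implyP=> le_zv; rewrite ltNge le_zv in lt_vz.
have [y [dy cy ly hy]] := IH (desc_tail dc).
move: dc; rewrite desc_cons => /andP[hc _].
exists (v :: y); split=> //.
- rewrite desc_cons dy andbT; have := hy v le_zv.
  case: (y) cy => [|w y'] //= _; apply.
  by case: (c) hc.
- by rewrite eqhead_ltxiE.
- by case: (y) cy ly; rewrite ?ltxis0.
Qed.

(* Below a limit omega^u all exponents z < u occur cofinally. *)
Lemma desc_between (b z : T) (x c : seqlexi_with d T) : desc x -> desc c ->
  (c < x)%O -> (z < last b x)%O -> exists y : seqlexi_with d T,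
    [/\ desc y, (c < y)%O, (y < x)%O & last b y = z].
Proof.
elim: x b c => [|u x IH] b c dx dc; first by rewrite ltxis0.
have [->|nz_x] := eqVneq x [::] => cu /= zu.
  have [y [dy cy ly hy]] := desc_insert z dc.
  exists y; split=> //; last by case: (y) cy ly; rewrite ?ltxis0.
  have hcu : (head z c < u)%O.
    case: (c) cu => [|v c'] //=; rewrite ltxi_cons ltxis0 implybF -ltNge.
    by case/andP.
  have {}hy : (head z y < u)%O.
    apply: (@le_lt_trans _ _ (Order.max z (head z c))); last by rewrite gt_max zu.
    by apply: hy; rewrite le_max lexx ?orbT.
  case: (y) cy hy => [|w y'] /=; first by rewrite ltxis0.
  by move=> _ wu; rewrite ltxi_cons (ltW wu) leNgt wu.
(* Cut a leading [u] off [c]; if [c] does not start with [u], it lies below [omega^u], and zero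
   serves as [c1]. *)
have [c1 [dc1 c1x cuc1]]: exists c1 : seqlexi_with d T,
    [/\ desc c1, (c1 < x)%O & (c <= ((u :: c1) : seqlexi_with d T))%O].
  have x_gt0 : (([::] : seqlexi_with d T) < x)%O by rewrite ltxi0s.
  case: c dc cu => [|v c] dc; first by exists [::].
  rewrite ltxi_cons => /andP[le_vu /implyP cx].
  have [le_uv|lt_vu] := leP u v; last first.
    by exists [::]; split=> //; rewrite lexi_cons (ltW lt_vu) leNgt lt_vu.
  exists c; split; [exact: desc_tail dc|exact: cx|].
  by rewrite lexi_cons le_vu le_uv /=.
have [y [dy c1y yx ly]] := IH u c1 (desc_tail dx) dc1 c1x zu.
exists (u :: y); split=> //.
- rewrite desc_cons dy andbT; apply: head_lexi_le (ltW yx) _.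
  by move: dx; rewrite desc_cons; case: (x) => //= w x' /andP[].
- by apply: le_lt_trans cuc1 _; rewrite eqhead_ltxiE.
- by rewrite eqhead_ltxiE.
Qed.

End OmegaPower.

(** * Well-orders with a least element and the last exponent *)

Record wo := WO {
  wdisp : Order.disp_t;
  wsort :> orderType wdisp;
  wbot : wsort;
  wbotP : forall x : wsort, (wbot <= x)%O;
  wwf : well_founded (fun x y : wsort => (x < y)%O)
}.

Section WoPower.
Variable X : wo.

Definition opow0 : opow (wsort X) := @Opow _ (wsort X) [::] isT.

Lemma opow0P (x : opow (wsort X)) : (opow0 <= x)%O.
Proof. exact: lexi0s. Qed.

Definition wpow : wo := WO opow0P (opow_wf (wwf (w := X))).

(** Zero, the empty list, gets the least exponent. Nothing lies below that one, so zero is no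
    exception in [expo_between]. *)
Definition expo (x : wpow) : X := last (wbot X) (oval x).

(** [None] is an endpoint below everything, so that zero has left neighbourhoods too. *)
Definition above (c : option wpow) (y : wpow) : bool :=
  if c is Some c' then (c' < y)%O else true.

Lemma above_max c1 c2 (x : wpow) : above c1 x -> above c2 x ->
  exists c, above c x /\ forall y, above c y -> above c1 y && above c2 y.
Proof.
case: c1 c2 => [c1|] [c2|] /= h1 h2.
- exists (Some (Order.max c1 c2)) => /=; rewrite gt_max h1 h2; split=> // y.
  by rewrite gt_max.
- by exists (Some c1); split=> // y /= ->.
- by exists (Some c2); split=> // y /= ->.
- by exists None.
Qed.

Lemma expo_between c (x : wpow) (z : X) : above c x -> (z < expo x)%O ->
  exists y : wpow, [/\ above c y, (y < x)%O & expo y = z].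
Proof.
move=> cx zx.
have x_gt0 : (opow0 < x)%O.
  rewrite lt_def opow0P andbT; apply/eqP=> x0; move: zx.
  by rewrite x0 /expo /= ltNge wbotP.
have [c' [c'x c'P]] : exists c' : wpow, (c' < x)%O /\ forall y, (c' < y)%O -> above c y.
  by case: c cx => [c|] cx; [exists c|exists opow0].
have [y [dy cy yx ly]] := desc_between (valP (x : opow _)) (valP (c' : opow _)) c'x zx.
by exists (Opow dy); split=> //; apply: c'P.
Qed.

Lemma expo_surj (z : X) : exists x : wpow, expo x = z.
Proof. by exists (@Opow _ (wsort X) [:: z] isT). Qed.

Lemma wpow_chain (k : nat) : exists x : wpow, oval x = nseq k (wbot X).
Proof.
have dk : desc (nseq k (wbot X)) by elim: k => [|[|k] IH] //=; rewrite lexx.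
by exists (Opow dk).
Qed.
End WoPower.

(** * The ordinal model *)

Section Frames.
Context {d : Order.disp_t} {L : orderType d}.

Record frame := Frame {
  fwo :> wo;
  freg : (fwo -> bool) -> Prop;
  fbox : L -> (fwo -> bool) -> fwo -> bool
}.

(** Axioms (iii) to (v) are required for [a] in [s] and arbitrary [b]: in the models built below,
    boxes outside [s] hold trivially on regular sets. By [good_lt], modalities look only at smaller
    points; this also yields necessitation. *)
Record good (s : seq L) (F : frame) : Prop := Good {
  good_true : @freg F xpredT;
  good_neg : forall T : F -> bool, freg T -> freg (fun x => ~~ T x);
  good_and : forall T U : F -> bool, freg T -> freg U -> freg (fun x => T x && U x);
  good_box : forall a (T : F -> bool), freg T -> freg (fbox a T);
  good_K : forall a (T U : F -> bool) x, freg T -> freg U ->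
    fbox a (fun y => ~~ (T y && ~~ U y)) x -> fbox a T x -> fbox a U x;
  good_lt : forall a (T : F -> bool) x, freg T ->
    (forall y : F, (y < x)%O -> T y) -> fbox a T x;
  good_loeb : forall a (T : F -> bool) x, freg T ->
    fbox a (fun y => ~~ (fbox a T y && ~~ T y)) x -> fbox a T x;
  good_trans : forall a b (T : F -> bool) x, freg T -> a \in s -> (a <= b)%O ->
    fbox a T x -> fbox b (fbox a T) x;
  good_dia : forall a b (T : F -> bool) x, freg T -> a \in s -> (a < b)%O ->
    ~~ fbox a T x -> fbox b (fun y => ~~ fbox a T y) x;
  good_mono : forall a b (T : F -> bool) x, freg T -> a \in s -> (a <= b)%O ->
    fbox a T x -> fbox b T x
}.

Lemma nat0P (x : nat) : (0 <= x)%O. Proof. by []. Qed.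

Lemma nat_wf : well_founded (fun x y : nat => (x < y)%O).
Proof.
have acc n : forall x, (x < n)%N -> Acc (fun x y : nat => (x < y)%O) x.
  elim: n => [|n IH] x xn; first by rewrite ltn0 in xn.
  constructor=> y; rewrite ltEnat /= => yx.
  by apply: IH; exact: leq_trans yx xn.
by move=> x; apply: (acc x.+1); exact: ltnSn.
Qed.

Definition nat_wo : wo := WO nat0P nat_wf.

Definition frame0 : frame :=
  @Frame nat_wo (fun=> True) (fun _ _ _ => true).

Lemma good0 : good [::] frame0.
Proof. by split. Qed.

(** * Adding a new lowest modality *)

Section Step.
Variables (a : L) (F : frame).

(* On some interval with right end [x], [T] is the preimage of [S] under [expo]. *)
Definition near (T : wpow F -> bool) (S : F -> bool) (x : wpow F) : Prop :=
  exists c, above c x /\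
    forall y : wpow F, above c y -> (y <= x)%O -> T y = S (expo y).

Definition sreg (T : wpow F -> bool) : Prop :=
  forall x, exists S, freg S /\ near T S x.

Definition sbox (b : L) (T : wpow F -> bool) (x : wpow F) : bool :=
  if b == a then `[< forall y : wpow F, (y < x)%O -> T y >]
  else `[< exists S, [/\ freg S, near T S x & fbox b S (expo x)] >].

Definition fstep : frame := @Frame (wpow F) sreg sbox.

Variable s : seq L.
Hypothesis goodF : good s F.
Hypothesis a_s : forall b, b \in s -> (a < b)%O.

Lemma near2 T S T' S' x : near T S x -> near T' S' x -> exists c, above c x /\
  forall y, above c y -> (y <= x)%O -> T y = S (expo y) /\ T' y = S' (expo y).
Proof.
move=> [c1 [c1x h1]] [c2 [c2x h2]]; have [c [cx hc]] := above_max c1x c2x.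
exists c; split=> // y cy yx; have /andP[y1 y2] := hc y cy.
by split; [apply: h1|apply: h2].
Qed.

Lemma near_const b x : near (fun=> b) (fun=> b) x.
Proof. by exists None. Qed.

Lemma near_neg (T : wpow F -> bool) (S : F -> bool) x :
  near T S x -> near (fun y => ~~ T y) (fun z => ~~ S z) x.
Proof. by move=> [c [cx h]]; exists c; split=> // y cy yx; rewrite h. Qed.

Lemma near_and (T T' : wpow F -> bool) (S S' : F -> bool) x :
  near T S x -> near T' S' x ->
  near (fun y => T y && T' y) (fun z => S z && S' z) x.
Proof.
move=> h1 h2; have [c [cx h]] := near2 h1 h2.
by exists c; split=> // y cy yx; have [-> ->] := h y cy yx.
Qed.

Lemma freg_imp (S S' : F -> bool) : freg S -> freg S' ->
  freg (fun y => ~~ (S y && ~~ S' y)).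
Proof. by move=> *; apply/(good_neg goodF)/(good_and goodF) => //; apply: (good_neg goodF). Qed.

Lemma near_lt (T : wpow F -> bool) (S : F -> bool) x z :
  near T S x -> (forall y : wpow F, (y < x)%O -> T y) ->
  (z < expo x)%O -> S z.
Proof.
move=> [c [cx h]] hT zx; have [y [cy yx <-]] := expo_between cx zx.
by rewrite -h ?hT // ltW.
Qed.

(** The choice of [S] is immaterial: two candidates agree at all exponents below [expo x], since
    these occur cofinally below [x], and by [good_lt] and [good_K] a box depends only on smaller
    points. *)
Lemma sbox_near b T S x : b != a -> freg S -> near T S x ->
  sbox b T x = fbox b S (expo x).
Proof.
move=> /negPf ba rS nTS; rewrite /sbox ba; apply/asboolP/idP => [[S' [rS' nTS' bS']]|].
  apply: (good_K goodF rS' rS) bS'; apply: (good_lt goodF); first exact: freg_imp.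
  move=> z zx; have [c [cx h]] := near2 nTS nTS'.
  have [y [cy yx <-]] := expo_between cx zx.
  by have [<- <-] := h y cy (ltW yx); case: (T y).
by exists S.
Qed.

Lemma near_sbox b T S x : b != a -> freg S -> near T S x ->
  near (sbox b T) (fbox b S) x.
Proof.
move=> ba rS [c [cx h]]; exists c; split=> // y cy yx.
apply: sbox_near => //; exists c; split=> // z cz zy.
by apply: h => //; apply: le_trans yx.
Qed.

Lemma sboxaP (T : wpow F -> bool) x :
  reflect (forall y : wpow F, (y < x)%O -> T y) (sbox a T x).
Proof. by rewrite /sbox eqxx; apply: asboolP. Qed.

(* If some [m < x] refutes [T], then [sbox a T] is false on the whole interval
   from [m] (excluded) to [x]. *)
Lemma near_sboxa (T : wpow F -> bool) x : near (sbox a T) (fun=> sbox a T x) x.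
Proof.
case: (boolP (sbox a T x)) => [/sboxaP hx|/sboxaP hx].
  exists None; split=> // y _ yx; apply/sboxaP=> z zy; apply: hx.
  exact: lt_le_trans yx.
have [m [mx Tm]] : exists m : wpow F, (m < x)%O /\ ~~ T m.
  by apply: contrapT=> no; apply: hx => y yx; apply/negPn/negP=> Ty; apply: no; exists y.
exists (Some m); split=> // y /= my _; apply/sboxaP=> h.
by rewrite h in Tm.
Qed.

Lemma freg_const (b : bool) : @freg F (fun=> b).
Proof. by case: b; [exact: (good_true goodF)|exact: (good_neg goodF (good_true goodF))]. Qed.

Lemma sreg_box b (T : wpow F -> bool) : sreg T -> sreg (sbox b T).
Proof.
move=> rT x; have [->|ba] := eqVneq b a.
  by exists (fun=> sbox a T x); split; [exact: freg_const|exact: near_sboxa].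
have [S [rS nTS]] := rT x; exists (fbox b S); split; first exact: (good_box goodF).
exact: near_sbox.
Qed.

Lemma sbox_lt b (T : wpow F -> bool) x :
  sreg T -> (forall y : wpow F, (y < x)%O -> T y) -> sbox b T x.
Proof.
move=> rT hT; have [->|ba] := eqVneq b a; first exact/sboxaP.
have [S [rS nTS]] := rT x; rewrite (sbox_near ba rS nTS).
by apply: (good_lt goodF) => // z; apply: near_lt nTS hT.
Qed.

(** For [a] itself the laws come from the order on [wpow F] being transitive and well-founded.
    Between modalities other than [a] they are inherited from [F] at [expo x]. The mixed cases use
    that [a] looks at all smaller points and that [sbox a T] is locally constant from the left. *)
Lemma good_step : good (a :: s) fstep.
Proof.
split=> /=.
- by move=> x; exists xpredT; split; [exact: (good_true goodF)|exact: near_const].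
- move=> T rT x; have [S [rS nTS]] := rT x.
  by exists (fun z => ~~ S z); split; [exact: (good_neg goodF)|exact: near_neg].
- move=> T U rT rU x; have [S [rS nTS]] := rT x; have [V [rV nUV]] := rU x.
  by exists (fun z => S z && V z); split; [exact: (good_and goodF)|exact: near_and].
- exact: sreg_box.
- move=> b T U x rT rU; have [->|ba] := eqVneq b a.
    move=> /sboxaP hTU /sboxaP hT; apply/sboxaP=> y yx.
    by move: (hTU y yx); rewrite hT //= negbK.
  have [S [rS nTS]] := rT x; have [V [rV nUV]] := rU x.
  rewrite (sbox_near ba rS nTS) (sbox_near ba rV nUV).
  rewrite (sbox_near ba (freg_imp rS rV) (near_neg (near_and nTS (near_neg nUV)))).
  exact: (good_K goodF).
- exact: sbox_lt.
- move=> b T x rT; have [->|ba] := eqVneq b a.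
    move=> /sboxaP hx; apply/sboxaP=> y.
    elim/(well_founded_induction (wwf (w := wpow F))): y => y IH yx.
    have := hx y yx; rewrite negb_and negbK => /orP[|//] /sboxaP; case=> z zy.
    by apply: IH => //; apply: lt_trans yx.
  have [S [rS nTS]] := rT x; have nb := near_sbox ba rS nTS.
  rewrite (sbox_near ba rS nTS).
  rewrite (sbox_near ba (freg_imp (good_box goodF b rS) rS)
    (near_neg (near_and nb (near_neg nTS)))).
  exact: (good_loeb goodF).
- move=> b c T x rT; rewrite inE; have [->|ba /=] := eqVneq b a.
    move=> _ _ /sboxaP hx; apply: sbox_lt; first exact: sreg_box.
    by move=> y yx; apply/sboxaP=> z zy; apply: hx; apply: lt_trans yx.
  move=> bs bc; have ca : c != a by rewrite gt_eqF // (lt_le_trans (a_s bs)).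
  have [S [rS nTS]] := rT x; rewrite (sbox_near ba rS nTS).
  rewrite (sbox_near ca (good_box goodF b rS) (near_sbox ba rS nTS)).
  exact: (good_trans goodF).
(* For the lowest modality, a failure of [sbox a T] at [x] persists on an interval ending in [x];
   its complement is thus near the constant true, and every higher box of it holds. *)
- move=> b c T x rT; rewrite inE; have [-> _ ac|ba /=] := eqVneq b a.
    have ca : c != a by rewrite gt_eqF.
    move=> nx; rewrite (sbox_near ca (freg_const true)).
      by apply: (good_lt goodF) => //; exact: freg_const.
    by have := near_neg (near_sboxa T x); rewrite nx.
  move=> bs bc; have ca : c != a by rewrite gt_eqF // (lt_trans (a_s bs)).
  have [S [rS nTS]] := rT x; rewrite (sbox_near ba rS nTS).
  rewrite (sbox_near ca (good_neg goodF (good_box goodF b rS))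
    (near_neg (near_sbox ba rS nTS))).
  exact: (good_dia goodF).
- move=> b c T x rT; rewrite inE; have [->|ba /=] := eqVneq b a.
    by move=> _ _ /sboxaP hx; apply: sbox_lt.
  move=> bs bc; have ca : c != a by rewrite gt_eqF // (lt_le_trans (a_s bs)).
  have [S [rS nTS]] := rT x; rewrite (sbox_near ba rS nTS) (sbox_near ca rS nTS).
  exact: (good_mono goodF).
Qed.

End Step.

(** * Soundness and satisfiability in the iterated model *)

Fixpoint model (s : seq L) : frame :=
  if s is a :: s' then fstep a (model s') else frame0.

Lemma good_model s : sorted (fun x y : L => x < y)%O s -> good s (model s).
Proof.
elim: s => [|a s IH] /=; first by move=> _; exact: good0.
rewrite (path_sortedE lt_trans) => /andP[/allP h s_s].
by apply: good_step => //; apply: IH.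
Qed.

(** Variables may occur in a derivation of a closed formula; they are read as false. *)
Fixpoint sem (F : frame) (f : form L) : F -> bool :=
  match f with
  | Var _ => xpred0
  | Top => xpredT
  | Neg f1 => fun x => ~~ sem f1 x
  | And f1 f2 => fun x => sem f1 x && sem f2 x
  | Box a f1 => fbox a (sem f1)
  end.

Lemma sem_reg s F (f : form L) : good s F -> freg (@sem F f).
Proof.
move=> goodF; elim: f => [n||f IH|f IHf g IHg|b f IH] /=.
- exact: (good_neg goodF (good_true goodF)).
- exact: (good_true goodF).
- exact: (good_neg goodF).
- exact: (good_and goodF).
- exact: (good_box goodF).
Qed.

Lemma sem_peval F (f : form L) x : @sem F f x = peval (fun g => @sem F g x) f.
Proof. by elim: f => //= [f ->|f -> g ->]. Qed.

Lemma sem_imp F (f g : form L) x :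
  @sem F (Imp f g) x = (@sem F f x ==> @sem F g x).
Proof. by rewrite /= negb_and negbK implybE. Qed.

(** [s0] collects the modalities [a] of the instances of axioms (iii) to (v) in the derivation, of
    which there are finitely many. *)
Lemma sem_sound (f : form L) : GLP f -> exists s0 : seq L,
  forall s F, {subset s0 <= s} -> good s F -> forall x, @sem F f x.
Proof.
elim=> {f}.
- by move=> f tf; exists [::] => s F _ goodF x; rewrite sem_peval; exact: tf.
- move=> a f g; exists [::] => s F _ goodF x.
  rewrite !sem_imp; apply/implyP=> h; apply/implyP.
  by apply: (good_K goodF) => //; exact: sem_reg goodF.
- move=> a f; exists [::] => s F _ goodF x; rewrite sem_imp; apply/implyP.
  by apply: (good_loeb goodF); exact: sem_reg goodF.
- move=> a b f ab; exists [:: a] => s F sub goodF x; rewrite sem_imp; apply/implyP.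
  by apply: (good_trans goodF) => //; [exact: sem_reg goodF|apply: sub; rewrite mem_head].
- move=> a b f ab; exists [:: a] => s F sub goodF x; rewrite sem_imp; apply/implyP.
  apply: (good_dia goodF) => //; last by apply: sub; rewrite mem_head.
  exact: (good_neg goodF (sem_reg f goodF)).
- move=> a b f ab; exists [:: a] => s F sub goodF x; rewrite sem_imp; apply/implyP.
  by apply: (good_mono goodF) => //; [exact: sem_reg goodF|apply: sub; rewrite mem_head].
- move=> f g _ [s1 h1] _ [s2 h2]; exists (s1 ++ s2) => s F sub goodF x.
  have hf : @sem F f x.
    by apply: (h2 s) => // y ys; apply: sub; rewrite mem_cat ys orbT.
  have := h1 s F _ goodF x; rewrite sem_imp hf; apply=> y ys.
  by apply: sub; rewrite mem_cat ys.
- move=> a f _ [s0 h]; exists s0 => s F sub goodF x /=.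
  by apply: (good_lt goodF) => [|y _]; [exact: sem_reg goodF|exact: h goodF y].
Qed.

(** The list of [k] least exponents is the finite ordinal [k], and [k] steps of the lowest modality
    lead down from it. *)
Lemma sem_chain k b (F : frame) (x : wpow F) : oval x = nseq k (wbot F) ->
  @sem (fstep b F) (iter k (Dia b) Top) x.
Proof.
elim: k x => //= k IH x ex; apply/sboxaP; have [y ey] := wpow_chain F k => h.
have /negP[] : ~~ @sem (fstep b F) (iter k (Dia b) Top) y; last exact: IH.
apply: h; rewrite opow_ltE ex ey; elim: (k) => // m IHm.
by rewrite /= eqhead_ltxiE.
Qed.

Lemma sem_step s a b (F : frame) k (x : wpow F) : good s F -> b != a ->
  @sem (fstep a F) (iter k (Dia b) Top) x = @sem F (iter k (Dia b) Top) (expo x).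
Proof.
move=> goodF ba; elim: k x => //= k IH x; congr (~~ _).
rewrite (@sbox_near _ _ _ goodF _ _ (fun z => ~~ @sem F (iter k (Dia b) Top) z)) //.
  exact: (good_neg goodF (sem_reg _ goodF)).
by exists None; split=> // y _ _; rewrite IH.
Qed.

(** At the level of [b] a finite ordinal is a witness; each lower modality lifts a witness to a
    point having it as last exponent. *)
Lemma sem_dia_sat s b k : sorted (fun x y : L => x < y)%O s -> b \in s ->
  exists x, @sem (model s) (iter k (Dia b) Top) x.
Proof.
elim: s => //= a s IH s_s; have s_s' := path_sorted s_s.
rewrite inE; have [->|ba] := eqVneq b a => /=.
  by move=> _; have [x ex] := wpow_chain (model s) k; exists x; exact: sem_chain.
move=> /(IH s_s')[x hx]; have [y ey] := expo_surj x.
by exists y; rewrite (sem_step _ _ (good_model s_s')) // ey.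
Qed.

Lemma GLP_valid_model (f : form L) (s1 : seq L) : GLP f ->
  exists s, [/\ sorted (fun x y : L => x < y)%O s, {subset s1 <= s} &
    forall x, @sem (model s) f x].
Proof.
move=> /sem_sound[s0 h].
pose s := sort (fun x y : L => x <= y)%O (undup (s1 ++ s0)).
have s_s : sorted (fun x y : L => x < y)%O s.
  by rewrite lt_sorted_uniq_le sort_uniq undup_uniq sort_le_sorted.
have mem_s x : (x \in s) = (x \in s1) || (x \in s0).
  by rewrite mem_sort mem_undup mem_cat.
exists s; split=> //; first by move=> x xs1; rewrite mem_s xs1.
by apply: h (good_model s_s) => x xs0; rewrite mem_s xs0 orbT.
Qed.

Lemma GLP_consistent : ~ GLP (Neg (@Top L)).
Proof. by move=> /(GLP_valid_model [::])[s [_ _ /(_ (wbot _))]]. Qed.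

Lemma GLP_dia_consistent (b : L) k : ~ GLP (Neg (iter k (Dia b) Top)).
Proof.
move=> /(GLP_valid_model [:: b])[s [s_s /(_ b (mem_head _ _)) b_s h]].
have [x hx] := sem_dia_sat k s_s b_s.
by have /= := h x; rewrite hx.
Qed.

End Frames.

(** * Worms *)

Ltac ptaut := let v := fresh "v" in move=> v /=;
  repeat match goal with
  | |- context [peval v ?f] => case: (peval v f)
  | |- context [v ?f] => case: (v f)
  end; by [].

Section Syntax.
Context {d : Order.disp_t} {L : orderType d}.
Implicit Types (f g h : form L) (a b c : L) (A B C M R : seq L).

Definition ent f g : Prop := GLP (Imp f g).
Definition eqv f g : Prop := ent f g /\ ent g f.

Lemma GLP_tc1 f g : GLP f -> (forall v, peval v f ==> peval v g) -> GLP g.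
Proof.
move=> hf h; apply: GLP_MP hf; apply: GLP_taut => v /=.
by move: (h v); case: (peval v f); case: (peval v g).
Qed.

Lemma GLP_tc2 f1 f2 g : GLP f1 -> GLP f2 ->
  (forall v, peval v f1 ==> peval v f2 ==> peval v g) -> GLP g.
Proof.
move=> h1 h2 h; apply: GLP_MP h2; apply: (GLP_tc1 h1) => v /=.
by move: (h v); case: (peval v f1); case: (peval v f2); case: (peval v g).
Qed.

Lemma GLP_tc3 f1 f2 f3 g : GLP f1 -> GLP f2 -> GLP f3 ->
  (forall v, peval v f1 ==> peval v f2 ==> peval v f3 ==> peval v g) -> GLP g.
Proof.
move=> h1 h2 h3 h; apply: GLP_MP h3; apply: (GLP_tc2 h1 h2) => v /=.
by move: (h v); case: (peval v f1); case: (peval v f2);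
  case: (peval v f3); case: (peval v g).
Qed.

Lemma ent_refl f : ent f f.
Proof. by apply: GLP_taut; ptaut. Qed.

Lemma ent_trans g f h : ent f g -> ent g h -> ent f h.
Proof. by move=> h1 h2; apply: (GLP_tc2 h1 h2); ptaut. Qed.

Lemma ent_and f g h : ent f g -> ent f h -> ent f (And g h).
Proof. by move=> h1 h2; apply: (GLP_tc2 h1 h2); ptaut. Qed.

Lemma ent_box a f g : ent f g -> ent (Box a f) (Box a g).
Proof. by move=> h; apply: GLP_MP (GLP_K a f g) _; apply: GLP_nec. Qed.

Lemma ent_dia a f g : ent f g -> ent (Dia a f) (Dia a g).
Proof.
move=> h; have /(ent_box a) h1 : ent (Neg g) (Neg f) by apply: (GLP_tc1 h); ptaut.
by apply: (GLP_tc1 h1); ptaut.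
Qed.

Lemma dia_box a f g : ent (And (Dia a f) (Box a g)) (Dia a (And f g)).
Proof.
have /(ent_box a) h1 : ent (Neg (And f g)) (Imp g (Neg f)) by apply: GLP_taut; ptaut.
by apply: (GLP_tc2 h1 (GLP_K a g (Neg f))); ptaut.
Qed.

Lemma dia_mono a b f : (a <= b)%O -> ent (Dia b f) (Dia a f).
Proof. by move=> ab; apply: (GLP_tc1 (GLP_mono (Neg f) ab)); ptaut. Qed.

Lemma dia_dia a b f : (a <= b)%O -> ent (Dia b (Dia a f)) (Dia a f).
Proof.
move=> ab; have /(ent_box b) h : ent (Box a (Neg f)) (Neg (Dia a f)).
  by apply: GLP_taut; ptaut.
by apply: (GLP_tc2 (GLP_box (Neg f) ab) h); ptaut.
Qed.

Lemma ndia_box a b f : (a <= b)%O -> ent (Neg (Dia a f)) (Box b (Neg (Dia a f))).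
Proof. by move=> ab; apply: (GLP_tc1 (dia_dia f ab)); ptaut. Qed.

Lemma dia_loeb a f : ent (Dia a f) (Dia a (And f (Neg (Dia a f)))).
Proof.
have /(ent_box a) h : ent (Neg (And f (Neg (Dia a f)))) (Imp (Box a (Neg f)) (Neg f)).
  by apply: GLP_taut; ptaut.
by apply: (GLP_tc2 h (GLP_Loeb a (Neg f))); ptaut.
Qed.

(** By Loeb's axiom a satisfiable [f] holds at some point after which it fails; the hypothesis
    excludes such points. *)
Lemma dia_irrefl a f : ent f (Dia a f) -> GLP (Neg f).
Proof.
move=> h; have h1 : GLP (Neg (And f (Neg (Dia a f)))) by apply: (GLP_tc1 h); ptaut.
apply: (GLP_tc3 h (dia_loeb a f) (GLP_nec a h1)); ptaut.
Qed.

Definition worm A : form L := foldr (@Dia L) Top A.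

(** Under this condition the worm [A ++ R] is equivalent to the conjunction of the worms [A] and
    [R], as the next lemmas show. *)
Definition sep A R : bool := if R is c :: _ then all (fun b => c < b)%O A else true.

Lemma worm_catl A R : ent (worm (A ++ R)) (worm A).
Proof.
elim: A => [|a A IH] /=; first by apply: GLP_taut; ptaut.
exact: ent_dia.
Qed.

Lemma worm_catr A R : sep A R -> ent (worm (A ++ R)) (worm R).
Proof.
elim: A => [|a A IH] sA /=; first exact: ent_refl.
have {}IH : ent (worm (A ++ R)) (worm R).
  by apply: IH; move: sA; case: (R) => //= c R' /andP[].
apply: ent_trans (ent_dia a IH) _; case: R sA {IH} => [|c R] /=.
  by move=> _; apply: GLP_taut; ptaut.
by case/andP=> /ltW ca _; exact: dia_dia.
Qed.

Lemma worm_box a R : sep [:: a] R -> ent (worm R) (Box a (worm R)).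
Proof.
case: R => [|c R] /=; last by rewrite andbT => ca; exact: GLP_dia.
move=> _; have h : GLP (Box a (@Top L)) by apply/GLP_nec/GLP_taut; ptaut.
by apply: (GLP_tc1 h); ptaut.
Qed.

Lemma worm_nbox a R : sep [:: a] R -> ent (Neg (worm R)) (Box a (Neg (worm R))).
Proof.
case: R => [|c R] /=; last by rewrite andbT => /ltW ca; exact: ndia_box.
by move=> _; apply: GLP_taut; ptaut.
Qed.

(** The first letter of [R] lies below each letter [a] of [A], so axiom (iv) boxes the worm [R] by
    [a], and it moves inside the modalities of [A] one at a time. *)
Lemma worm_cat A R : sep A R -> ent (And (worm A) (worm R)) (worm (A ++ R)).
Proof.
elim: A => [|a A IH] sA /=; first by apply: GLP_taut; ptaut.
have sA' : sep A R by move: sA; case: (R) => //= c R' /andP[].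
have sa : sep [:: a] R by move: sA; case: (R) => //= c R' /andP[-> _].
apply: ent_trans (ent_dia a (IH sA')); apply: ent_trans (dia_box _ _ _).
by apply: (GLP_tc1 (worm_box sa)); ptaut.
Qed.

(** * Comparison and conjunction of worms *)

Definition gtw A B : Prop :=
  exists c, [/\ c \in A ++ B, all (fun b => c <= b)%O (A ++ B) &
    ent (worm A) (Dia c (worm B))].

Lemma gtw_dia c A B : all (fun b => c <= b)%O A -> all (fun b => c <= b)%O B ->
  gtw A B -> ent (worm A) (Dia c (worm B)).
Proof.
move=> cA cB [m [mAB _ h]]; apply: ent_trans h _; apply: dia_mono.
by have /allP := cA; have /allP := cB; move: mAB; rewrite mem_cat => /orP[] h1 h2 h3; auto.
Qed.

(** [false] merges equivalence with the reverse comparison; strict comparisons in both directions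
    suffice for the recursion. *)
Definition cmp_spec A B (x : bool) : Prop :=
  if x then gtw A B else eqv (worm A) (worm B) \/ gtw B A.

Lemma exists_min a A : exists c, c \in a :: A /\ all (fun b => c <= b)%O (a :: A).
Proof.
elim: A a => [|b A IH] a; first by exists a; rewrite mem_head /= lexx.
have [c [cA hc]] := IH b; have [ac|ca] := leP a c.
  exists a; rewrite mem_head /= lexx; split=> //.
  by apply: sub_all hc => x; apply: le_trans.
by exists c; rewrite inE cA orbT; split=> //=; rewrite (ltW ca).
Qed.

Lemma cmp_nil B : cmp_spec [::] B false.
Proof.
case: B => [|b B]; first by left; split; exact: ent_refl.
right; have [c [cB hc]] := exists_min b B; exists c; rewrite cats0; split=> //.
apply: (@ent_trans (Dia b Top)).
  by apply: ent_dia; apply: GLP_taut; ptaut.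
by apply: dia_mono; case/andP: hc.
Qed.

(** The shape of the suffix of a worm from the first occurrence of its least letter [c], empty if
    [c] does not occur. *)
Definition tailof c R : bool :=
  if R is b :: R' then (b == c) && all (fun x => c <= x)%O R' else true.

Lemma tailof_sep c A R : all (fun b => c < b)%O A -> tailof c R -> sep A R.
Proof. by case: R => [|b R] //= h /andP[/eqP -> _]. Qed.

Lemma tailof_low c R : tailof c R -> all (fun x => c <= x)%O R.
Proof. by case: R => [|b R] //= /andP[/eqP -> ->]; rewrite lexx. Qed.

Lemma all_ltW c A : all (fun b => c < b)%O A -> all (fun b => c <= b)%O A.
Proof. by apply: sub_all => x /ltW. Qed.

Lemma cmp_tail_true c A R : tailof c R -> all (fun b => c <= b)%O A ->
  (~~ nilp R -> cmp_spec A (behead R) true) -> ent (worm A) (worm R).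
Proof.
case: R => [|b R] /=; first by move=> _ _ _; apply: GLP_taut; ptaut.
by move=> /andP[/eqP -> cR] cA /(_ isT); apply: gtw_dia.
Qed.

(** With [R] being [c] followed by [R'], the worm [R'] is equivalent to [A] or lies above it; in the
    latter case two diamonds for [c] collapse into one. *)
Lemma cmp_tail_false c A R : tailof c R -> all (fun b => c <= b)%O A -> ~~ nilp R ->
  cmp_spec A (behead R) false -> ent (worm R) (Dia c (worm A)).
Proof.
case: R => [|b R] //= /andP[/eqP -> cR] cA _ [[_ h]|/(gtw_dia cR cA) h].
  exact: ent_dia.
exact: ent_trans (ent_dia _ h) (dia_dia _ (lexx c)).
Qed.

(* The recursion step of the comparison; [RA] and [RB] are the suffixes starting
   at the first [c]. *)
Lemma cmp_step c A1 RA B1 RB x1 x2 x3 :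
  all (fun b => c < b)%O A1 -> all (fun b => c < b)%O B1 ->
  tailof c RA -> tailof c RB -> ~~ (nilp RA && nilp RB) ->
  (~~ nilp RA -> cmp_spec (B1 ++ RB) (behead RA) x1) ->
  (~~ nilp RB -> cmp_spec (A1 ++ RA) (behead RB) x2) ->
  cmp_spec A1 B1 x3 ->
  cmp_spec (A1 ++ RA) (B1 ++ RB)
    ((~~ nilp RA && ~~ x1) || ((nilp RB || x2) && x3)).
Proof.
move=> cA1 cB1 tA tB nAB h1 h2 h3.
set A := A1 ++ RA; set B := B1 ++ RB.
have cA : all (fun b => c <= b)%O A by rewrite all_cat all_ltW ?tailof_low.
have cB : all (fun b => c <= b)%O B by rewrite all_cat all_ltW ?tailof_low.
have sA := tailof_sep cA1 tA; have sB := tailof_sep cB1 tB.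
have c_in : c \in A ++ B.
  rewrite !mem_cat; move: tA tB nAB; case: (RA) => [|x R1]; case: (RB) => [|y R2] //=.
  - by move=> _ /andP[/eqP -> _]; rewrite mem_head ?orbT.
  - by move=> /andP[/eqP -> _]; rewrite mem_head ?orbT.
  - by move=> /andP[/eqP -> _]; rewrite mem_head ?orbT.
have gtAB : ent (worm A) (Dia c (worm B)) -> gtw A B.
  by move=> h; exists c; rewrite all_cat cA cB.
have gtBA : ent (worm B) (Dia c (worm A)) -> gtw B A.
  by move=> h; exists c; rewrite all_cat cA cB mem_cat orbC -mem_cat.
have AA1 : ent (worm A) (worm A1) := worm_catl A1 RA.
have BB1 : ent (worm B) (worm B1) := worm_catl B1 RB.
have ARA : ent (worm A) (worm RA) := worm_catr sA.
have BRB : ent (worm B) (worm RB) := worm_catr sB.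
(* Letters of the heads exceed [c], so [<m>Y] with [m] above [c] absorbs the tail [RY] by
   [worm_cat]; then [m] is lowered to [c]. *)
have lift X Y RY Z : all (fun b => c < b)%O X -> all (fun b => c < b)%O Y ->
    tailof c RY -> gtw X Y -> ent Z (worm X) -> ent Z (worm RY) ->
    ent Z (Dia c (worm (Y ++ RY))).
  move=> cX cY tY [m [mXY _ hXY]] ZX ZR.
  have cm : (c < m)%O.
    by move: mXY; rewrite mem_cat => /orP[]; [move/(allP cX)|move/(allP cY)].
  apply: ent_trans (dia_mono _ (ltW cm)).
  apply: (@ent_trans (worm ((m :: Y) ++ RY))); last exact: ent_refl.
  apply: ent_trans (worm_cat _); last by apply: tailof_sep tY; rewrite /= cm.
  by apply: ent_and => //; exact: ent_trans hXY.
case x1e: (~~ nilp RA && ~~ x1) => /=.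
  move: x1e h1 => /andP[nA /negPf ->] /(_ nA) h1.
  by apply: gtAB; apply: ent_trans ARA (cmp_tail_false tA cB nA h1).
have BA : ent (worm B) (worm RA).
  apply: (cmp_tail_true tA cB) => nA; move: x1e (h1 nA).
  by rewrite nA /= => /negbFE ->.
case x2e: (nilp RB || x2) => /=; last first.
  right; apply: gtBA; move: x2e h2 => /norP[nB /negPf ->] /(_ nB) h2.
  exact: ent_trans BRB (cmp_tail_false tB cA nB h2).
have AB : ent (worm A) (worm RB).
  apply: (cmp_tail_true tB cA) => nB; move: x2e (h2 nB).
  by rewrite (negPf nB) /= => ->.
(* Each worm now entails the tail of the other, so the heads decide. *)
case: x3 h3 => h3; first by apply: gtAB; apply: lift h3 AA1 AB.
case: h3 => [[h4 h5]|h3]; last by right; apply: gtBA; apply: lift h3 BB1 BA.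
left; split.
  apply: ent_trans (worm_cat sB); apply: ent_and => //; exact: ent_trans h4.
apply: ent_trans (worm_cat sA); apply: ent_and => //; exact: ent_trans h5.
Qed.

(* The second clause says that the letters of [M] come from [A] and [B]. *)
Definition meet_spec A B M : Prop :=
  eqv (worm M) (And (worm A) (worm B)) /\
  forall P : pred L, all P A -> all P B -> all P M.

Lemma meet_nil B : meet_spec [::] B B.
Proof. by split=> //; split; apply: GLP_taut; ptaut. Qed.

(** Heads and tails are met separately. Two nonempty tails both start with [c], so the one whose
    remainder is higher entails the other and is their meet. The letters of [M] exceed [c], hence
    the two meets can be concatenated. *)
Lemma meet_step c A1 RA B1 RB M x :
  all (fun b => c < b)%O A1 -> all (fun b => c < b)%O B1 ->
  tailof c RA -> tailof c RB -> meet_spec A1 B1 M ->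
  (~~ nilp RA -> ~~ nilp RB -> cmp_spec (behead RB) (behead RA) x) ->
  meet_spec (A1 ++ RA) (B1 ++ RB)
    (M ++ (if nilp RA then RB else if nilp RB then RA else if x then RB else RA)).
Proof.
move=> cA1 cB1 tA tB [[hM1 hM2] hP] hx.
set R := (X in M ++ X).
have cM : all (fun b => c < b)%O M by exact: hP.
have [tR [hR1 hR2] hPR] : [/\ tailof c R, eqv (worm R) (And (worm RA) (worm RB)) &
    forall P : pred L, all P RA -> all P RB -> all P R].
  rewrite {}/R; case: RA tA hx => [|a A2] /=.
    by move=> _ _; split=> //; split; apply: GLP_taut; ptaut.
  case: RB tB => [|b B2] /=.
    by move=> _ tA _; split=> //; split; apply: GLP_taut; ptaut.
  move=> /andP[/eqP -> cB2] /andP[/eqP -> cA2] /(_ isT isT); case: x => hx.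
    split=> [||P _]//=; first by rewrite eqxx.
    have h : ent (Dia c (worm B2)) (Dia c (worm A2)).
      apply: ent_trans (dia_dia _ (lexx c)); apply: ent_dia; exact: gtw_dia hx.
    by split; [apply: ent_and => //; exact: ent_refl|apply: GLP_taut; ptaut].
  split=> [||P]//=; first by rewrite eqxx.
  have h : ent (Dia c (worm A2)) (Dia c (worm B2)).
    case: hx => [[_ h]|hx]; first exact: ent_dia.
    by apply: ent_trans (dia_dia _ (lexx c)); apply: ent_dia; exact: gtw_dia hx.
  by split; [apply: ent_and => //; exact: ent_refl|apply: GLP_taut; ptaut].
have sA := tailof_sep cA1 tA; have sB := tailof_sep cB1 tB; have sM := tailof_sep cM tR.
split; last by move=> P; rewrite !all_cat => /andP[? ?] /andP[? ?]; rewrite hP ?hPR.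
split.
  apply: ent_and.
    apply: ent_trans (worm_cat sA); apply: ent_and.
      by apply: (GLP_tc2 (worm_catl M R) hM1); ptaut.
    by apply: (GLP_tc2 (worm_catr sM) hR1); ptaut.
  apply: ent_trans (worm_cat sB); apply: ent_and.
    by apply: (GLP_tc2 (worm_catl M R) hM1); ptaut.
  by apply: (GLP_tc2 (worm_catr sM) hR1); ptaut.
apply: ent_trans (worm_cat sM); apply: ent_and.
  apply: ent_trans hM2; have h1 := worm_catl A1 RA; have h2 := worm_catl B1 RB.
  by apply: (GLP_tc2 h1 h2); ptaut.
apply: ent_trans hR2; have h1 := worm_catr sA; have h2 := worm_catr sB.
by apply: (GLP_tc2 h1 h2); ptaut.
Qed.

(** The negative case records a positive consequence instead of unprovability: at a point of [A]
    with no [c]-successor in [A], the worm [B] fails. Nonemptiness guarantees that a least letter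
    exists. *)
Definition imp_spec A B (x : bool) : Prop :=
  if x then ent (worm A) (worm B)
  else A ++ B != [::] /\
    forall c, all (fun b => c <= b)%O A -> all (fun b => c <= b)%O B ->
      ent (And (worm A) (worm B)) (Dia c (worm A)).

(** [A] entails [B] exactly when the meet of the two is not strictly above [A]. *)
Lemma imp_step A B M x : meet_spec A B M -> cmp_spec M A x -> imp_spec A B (~~ x).
Proof.
move=> [[hM1 hM2] hP]; case: x => /= [hx|[[_ h]|hx]].
- split=> [|c cA cB].
    (* If [A] and [B] were empty, so would be [M], by the clause on letters, leaving no letter to
       serve as [c]. *)
    have [c [+ _ _]] := hx; rewrite mem_cat => cMA; apply: contraTneq isT => AB0.
    have [cP cQ] : all (mem (A ++ B)) A /\ all (mem (A ++ B)) B.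
      by split; apply/allP=> y yA; rewrite /= mem_cat yA ?orbT.
    have /allP cM := hP _ cP cQ.
    by case/orP: cMA => [/cM|/(allP cP)]; rewrite /= AB0.
  by apply: ent_trans hM2 _; apply: gtw_dia => //; exact: hP.
- by apply: (GLP_tc2 h hM1); ptaut.
(* [M] entails [A], so [A] entails [<c>A]; by Loeb it is refutable and entails anything. *)
- have [c [_ + hc]] := hx; rewrite all_cat => /andP[cA cM].
  have h : ent (worm A) (Dia c (worm A)).
    apply: ent_trans hc _; apply: ent_dia; apply: ent_trans hM1 _.
    by apply: GLP_taut; ptaut.
  by apply: (GLP_tc1 (dia_irrefl h)); ptaut.
Qed.

(** * Normal forms, their diamonds and their consistency *)

Definition negs (Bs : seq (seq L)) : form L :=
  foldr (fun B f => And (Neg (worm B)) f) Top Bs.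

(* A pair [(A, Bs)] stands for the worm [A] and the negations of the worms in [Bs]. *)
Definition conj (p : seq L * seq (seq L)) : form L := And (worm p.1) (negs p.2).

Definition dnf (D : seq (seq L * seq (seq L))) : form L :=
  foldr (fun p f => Neg (And (Neg (conj p)) (Neg f))) (Neg Top) D.

Definition upto c A : seq L := take (find (fun b => b < c)%O A) A.
Definition from c A : seq L := drop (find (fun b => b < c)%O A) A.

Lemma upto_from c A : upto c A ++ from c A = A.
Proof. exact: cat_take_drop. Qed.

Lemma upto_all c A : all (fun b => c <= b)%O (upto c A).
Proof.
rewrite /upto; elim: A => //= a A IH.
by have [ac|ca] := ltP a c => //=; rewrite ca.
Qed.

Lemma from_sep c A B : all (fun b => c <= b)%O A -> sep A (from c B).
Proof.
move=> cA; rewrite /from; elim: B => //= b B IH; have [bc|//] := ltP b c.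
by rewrite /=; apply: sub_all cA => x; apply: lt_le_trans.
Qed.

(* [Cs] collects the conditions that survive outside the modality [c]. *)
Inductive dianeg c A : seq (seq L) -> seq (seq L) -> Prop :=
| dianeg_nil : dianeg c A [::] [::]
| dianeg_cons B Bs Cs (x : bool) : imp_spec A (upto c B) x -> dianeg c A Bs Cs ->
    dianeg c A (B :: Bs) (if x then from c B :: Cs else Cs).

(** If [from c B] held outside, axiom (iv) would carry it inside the modality, where it would
    combine with [upto c B], implied by [A], to the excluded worm [B]. *)
Lemma dianeg_outer c A Bs Cs : dianeg c (upto c A) Bs Cs ->
  ent (Dia c (And (worm A) (negs Bs))) (negs Cs).
Proof.
elim=> {Bs Cs} [|B Bs Cs x hx _ IH]; first by apply: GLP_taut; ptaut.
have h1 : ent (Dia c (And (worm A) (negs (B :: Bs)))) (negs Cs).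
  by apply: ent_trans IH; apply: ent_dia; apply: GLP_taut; ptaut.
case: x hx => //= hx; apply: ent_and h1.
have sB : sep [:: c] (from c B) by apply: from_sep; rewrite /= lexx.
set X := And _ _.
have h2 : ent (And X (worm (from c B))) (Neg Top).
  have sB' : sep (upto c B) (from c B) by apply/from_sep/upto_all.
  have := worm_catl (upto c A) (from c A); have := worm_cat sB'.
  rewrite !upto_from => h2 h3.
  by apply: (GLP_tc3 hx h2 h3); rewrite /X; ptaut.
have h3 := dia_box c X (worm (from c B)).
have h4 : GLP (Box c (Neg (And X (worm (from c B))))).
  by apply: GLP_nec; apply: (GLP_tc1 h2); ptaut.
by apply: (GLP_tc3 (worm_box sB) h3 h4); ptaut.
Qed.

(** At a last point of [A] each [B] fails: either its part [from c B] is denied by [Cs], or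
    [upto c B] would yield a further point of [A]. *)
Lemma dianeg_inner c A Bs Cs : all (fun b => c <= b)%O A -> dianeg c A Bs Cs ->
  ent (And (And (worm A) (Neg (Dia c (worm A)))) (negs Cs)) (negs Bs).
Proof.
move=> cA; elim=> {Bs Cs} [|B Bs Cs x hx _ IH]; first by apply: GLP_taut; ptaut.
have sB' : sep (upto c B) (from c B) by apply/from_sep/upto_all.
have := worm_catl (upto c B) (from c B); have := worm_catr sB'.
rewrite !upto_from => h2 h3.
case: x hx => hx; first by apply: (GLP_tc2 IH h2); ptaut.
have {}hx := hx.2 c cA (upto_all c B).
by apply: (GLP_tc3 hx IH h3); ptaut.
Qed.

(** A nonempty [from c B] starts below [c], so its negation persists by axiom (iii). *)
Lemma dianeg_box c A Bs Cs : dianeg c A Bs Cs -> ent (negs Cs) (Box c (negs Cs)).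
Proof.
elim=> {Bs Cs} [|B Bs Cs x hx _ IH].
  by apply: (GLP_tc1 (GLP_nec c (GLP_taut (f := Top) (fun=> isT)))); ptaut.
case: x hx => //= hx; set C := from c B.
have sB : sep [:: c] C by apply: from_sep; rewrite /= lexx.
have h : ent (Neg (worm C)) (Imp (negs Cs) (And (Neg (worm C)) (negs Cs))).
  by apply: GLP_taut; ptaut.
have := GLP_K c (negs Cs) (And (Neg (worm C)) (negs Cs)) => hK.
have h1 := ent_trans (worm_nbox sB) (ent_box c h).
by apply: (GLP_tc3 IH hK h1); ptaut.
Qed.

(** For the converse, Loeb's axiom provides a last [c]-successor satisfying [upto c A]; both
    [from c A] and the negations [Cs] persist to it, and [dianeg_inner] refutes all of [Bs]
    there. *)
Lemma conj_dia c A Bs Cs : dianeg c (upto c A) Bs Cs ->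
  eqv (Dia c (conj (A, Bs))) (conj (c :: A, Cs)).
Proof.
move=> h; split.
  apply: ent_and; last exact: dianeg_outer.
  by apply: ent_dia; apply: GLP_taut; ptaut.
rewrite /conj /=; set A1 := upto c A; set A2 := from c A.
have sA : sep (c :: A1) A2 by apply: from_sep; rewrite /= lexx upto_all.
have sc : sep [:: c] A2 by apply: from_sep; rewrite /= lexx.
have sA1 : sep A1 A2 by apply/from_sep/upto_all.
have h1 : ent (worm (c :: A)) (worm A2).
  by have := worm_catr sA; rewrite /= upto_from.
have h2 : ent (worm (c :: A)) (Dia c (worm A1)).
  by have := worm_catl (c :: A1) A2; rewrite /= upto_from.
have h3 := ent_trans h2 (dia_loeb c (worm A1)).
set Y := And (worm A1) _ in h3.
have h4 := dia_box c Y (worm A2).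
have h5 : ent (worm (c :: A)) (Dia c (And Y (worm A2))).
  apply: ent_trans h4; apply: ent_and => //; exact: ent_trans (worm_box sc).
have h6 := dia_box c (And Y (worm A2)) (negs Cs).
have h7 : ent (And (worm (c :: A)) (negs Cs)) (Dia c (And (And Y (worm A2)) (negs Cs))).
  apply: ent_trans h6; apply: (GLP_tc2 h5 (dianeg_box h)); ptaut.
apply: ent_trans h7 _; apply: ent_dia; apply: ent_and.
  by have := worm_cat sA1; rewrite upto_from => h8;
    apply: (GLP_tc1 h8); rewrite /Y; ptaut.
by have h8 := dianeg_inner (upto_all c A) h; apply: (GLP_tc1 h8); rewrite /Y; ptaut.
Qed.

(** Raising all letters to the greatest one, [m], strengthens the worm to an iterate of [<m>], which
    the model satisfies. *)
Lemma worm_consistent A : ~ GLP (Neg (worm A)).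
Proof.
case: A => [|a A]; first exact: GLP_consistent.
have [m hm] : exists m, all (fun b => b <= m)%O (a :: A).
  elim: A a => [|b A IH] a; first by exists a; rewrite /= lexx.
  have [m hm] := IH b; have [am|ma] := leP a m; first by exists m; rewrite /= am.
  by exists a; rewrite /= lexx; apply: sub_all hm => x xm; exact: le_trans (ltW ma).
move=> hA; apply: (@GLP_dia_consistent _ _ m (size (a :: A))).
have : ent (iter (size (a :: A)) (Dia m) Top) (worm (a :: A)).
  elim: (a :: A) hm => [|b B IH] /=; first by move=> _; exact: ent_refl.
  by case/andP=> bm /IH h; apply: ent_trans (ent_dia m h) _; exact: dia_mono.
by move=> h; apply: (GLP_tc2 h hA); ptaut.
Qed.

Lemma conj_inconsistent A B Bs :
  B \in Bs -> imp_spec A B true -> GLP (Neg (conj (A, Bs))).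
Proof.
rewrite /imp_spec /conj /= => + h; elim: Bs => //= C Bs IH.
rewrite inE => /orP[/eqP eB|/IH h1].
  by rewrite -eB; apply: (GLP_tc1 h); ptaut.
by apply: (GLP_tc1 h1); ptaut.
Qed.

(** A last point of [A] falsifies all of [Bs]. If the conjunction were refutable, [A] would entail
    [<c>A] and be refutable by Loeb. *)
Lemma conj_consistent A Bs : (forall B, B \in Bs -> imp_spec A B false) ->
  ~ GLP (Neg (conj (A, Bs))).
Proof.
case: Bs => [|B0 Bs'] h hc.
  by apply: (@worm_consistent A); apply: (GLP_tc1 hc); ptaut.
set Bs := B0 :: Bs' in h hc.
(* [c] is the least letter occurring in [A] or [Bs]; there is one because [A] and [B0] are not both
   empty. *)
have [c hA hB] : exists2 c, all (fun b => c <= b)%O A &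
    forall B, B \in Bs -> all (fun b => c <= b)%O B.
  have [] := h B0 (mem_head _ _); have mB0 : B0 \in Bs by rewrite mem_head.
  case E: (A ++ flatten Bs) => [|b C].
    by move: E => /=; case: (A) => [|//]; case: (B0).
  move=> _ _; have [c [_]] := exists_min b C; rewrite -E all_cat => /andP[cA /allP cB].
  by exists c => // B BBs; apply/allP=> x xB; apply: cB; apply/flattenP; exists B.
apply: (@worm_consistent A); apply: (@dia_irrefl c).
have {}h : ent (And (worm A) (Neg (Dia c (worm A)))) (negs Bs).
  elim: Bs {hc} h hB => [|B Cs IH] h hB; first by apply: GLP_taut; ptaut.
  have {}IH : ent (And (worm A) (Neg (Dia c (worm A)))) (negs Cs).
    by apply: IH => C CCs; [apply: h|apply: hB]; rewrite inE CCs orbT.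
  have [_ /(_ c hA (hB B (mem_head _ _))) h1] := h B (mem_head _ _).
  by apply: (GLP_tc2 IH h1); ptaut.
by apply: (GLP_tc2 hc h); ptaut.
Qed.

End Syntax.

(** * The program *)

(** These indices are the positions of the bodies in [prog]. *)
Definition i_cat := 1.
Definition i_min := 2.
Definition i_heads := 3.
Definition i_rest := 4.
Definition i_upto := 5.
Definition i_from := 6.
Definition i_gt := 7.
Definition i_gt_at := 8.
Definition i_meet := 9.
Definition i_meet_at := 10.
Definition i_imp := 11.
Definition i_dianeg := 12.
Definition i_dia := 13.
Definition i_and1 := 14.
Definition i_and := 15.
Definition i_negs := 16.
Definition i_neg := 17.
Definition i_nf := 18.
Definition i_has := 19.
Definition i_all := 20.

Definition ETrue := ECons ENil ENil.
Definition ENot e := EIf e ENil ETrue.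
Definition EFst := EHd EArg.
Definition ESnd := ETl EArg.

(* argument: (s . t) *)
Definition b_cat :=
  EIf EFst (ECons (EHd EFst) (ECall i_cat (ECons (ETl EFst) ESnd))) ESnd.

(* argument: a nonempty list of atoms *)
Definition b_min :=
  EIf ESnd
    (EIf (EOracle (EHd ESnd) EFst) (ECall i_min ESnd)
         (ECall i_min (ECons EFst (ETl ESnd))))
    EFst.

(* argument of the next four: (c . A) *)
Definition b_heads :=
  EIf ESnd
    (EIf (EOracle EFst (EHd ESnd))
       (ECons (EHd ESnd) (ECall i_heads (ECons EFst (ETl ESnd)))) ENil)
    ENil.

Definition b_rest :=
  EIf ESnd
    (EIf (EOracle EFst (EHd ESnd)) (ECall i_rest (ECons EFst (ETl ESnd))) ESnd)
    ENil.

Definition b_upto :=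
  EIf ESnd
    (EIf (EOracle (EHd ESnd) EFst)
       ENil (ECons (EHd ESnd) (ECall i_upto (ECons EFst (ETl ESnd)))))
    ENil.

Definition b_from :=
  EIf ESnd
    (EIf (EOracle (EHd ESnd) EFst) ESnd (ECall i_from (ECons EFst (ETl ESnd))))
    ENil.

(* argument: (A . B) *)
Definition b_gt :=
  EIf EFst (ECall i_gt_at (ECons (ECall i_min (ECall i_cat EArg)) EArg)) ENil.

Definition on_fst i := ECall i (ECons EFst (EHd ESnd)).
Definition on_snd i := ECall i (ECons EFst (ETl ESnd)).

(* argument: (c . (A . B)) *)
Definition b_gt_at :=
  EIf (EIf (on_fst i_rest)
         (ENot (ECall i_gt (ECons (ETl ESnd) (ETl (on_fst i_rest))))) ENil)
    ETrue
    (EIf (EIf (on_snd i_rest)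
            (ECall i_gt (ECons (EHd ESnd) (ETl (on_snd i_rest)))) ETrue)
       (ECall i_gt (ECons (on_fst i_heads) (on_snd i_heads))) ENil).

(* argument: (A . B) *)
Definition b_meet :=
  EIf EFst (ECall i_meet_at (ECons (ECall i_min (ECall i_cat EArg)) EArg)) ESnd.

(* argument: (c . (A . B)) *)
Definition b_meet_at :=
  ECall i_cat (ECons
    (ECall i_meet (ECons (on_fst i_heads) (on_snd i_heads)))
    (EIf (on_fst i_rest)
       (EIf (on_snd i_rest)
          (EIf (ECall i_gt (ECons (ETl (on_snd i_rest)) (ETl (on_fst i_rest))))
             (on_snd i_rest) (on_fst i_rest))
          (on_fst i_rest))
       (on_snd i_rest))).

(* argument: (A . B) *)
Definition b_imp := ENot (ECall i_gt (ECons (ECall i_meet EArg) EFst)).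

(* argument: (c . (A . Bs)) *)
Definition b_dianeg :=
  EIf (ETl ESnd)
    (EIf (ECall i_imp (ECons (EHd ESnd)
            (ECall i_upto (ECons EFst (EHd (ETl ESnd))))))
       (ECons (ECall i_from (ECons EFst (EHd (ETl ESnd))))
          (ECall i_dianeg (ECons EFst (ECons (EHd ESnd) (ETl (ETl ESnd))))))
       (ECall i_dianeg (ECons EFst (ECons (EHd ESnd) (ETl (ETl ESnd))))))
    ENil.

(* argument: (c . D) *)
Definition b_dia :=
  EIf ESnd
    (ECons
       (ECons (ECons EFst (EHd (EHd ESnd)))
          (ECall i_dianeg (ECons EFst
             (ECons (ECall i_upto (ECons EFst (EHd (EHd ESnd))))
                (ETl (EHd ESnd))))))
       (ECall i_dia (ECons EFst (ETl ESnd))))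
    ENil.

(* argument: (p . E) *)
Definition b_and1 :=
  EIf ESnd
    (ECons
       (ECons (ECall i_meet (ECons (EHd EFst) (EHd (EHd ESnd))))
          (ECall i_cat (ECons (ETl EFst) (ETl (EHd ESnd)))))
       (ECall i_and1 (ECons EFst (ETl ESnd))))
    ENil.

(* argument: (D . E) *)
Definition b_and :=
  EIf EFst
    (ECall i_cat (ECons (ECall i_and1 (ECons (EHd EFst) ESnd))
       (ECall i_and (ECons (ETl EFst) ESnd))))
    ENil.

(* argument: Bs *)
Definition b_negs :=
  EIf EArg (ECons (ECons EFst ENil) (ECall i_negs ESnd)) ENil.

(* argument: D *)
Definition b_neg :=
  EIf EArg
    (ECall i_and (ECons
       (ECons (ECons ENil (ECons (EHd EFst) ENil)) (ECall i_negs (ETl EFst)))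
       (ECall i_neg ESnd)))
    (ECons (ECons ENil ENil) ENil).

(* argument: a closed formula *)
Definition b_nf :=
  EIf EFst
    (EIf (ETl EFst)
       (EIf (ETl (ETl EFst))
          (ECall i_neg (ECall i_dia (ECons (EHd ESnd)
             (ECall i_neg (ECall i_nf (ETl ESnd))))))
          (ECall i_and (ECons (ECall i_nf (EHd ESnd)) (ECall i_nf (ETl ESnd)))))
       (ECall i_neg (ECall i_nf ESnd)))
    (ECons (ECons ENil ENil) ENil).

(* argument: (A . Bs) *)
Definition b_has :=
  EIf ESnd
    (EIf (ECall i_imp (ECons EFst (EHd ESnd)))
       ETrue (ECall i_has (ECons EFst (ETl ESnd))))
    ENil.

(* argument: D *)
Definition b_all :=
  EIf EArg (EIf (ECall i_has EFst) (ECall i_all ESnd) ENil) ETrue.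

(* argument: a closed formula *)
Definition b_main := ECall i_all (ECall i_neg (ECall i_nf EArg)).

Definition prog : program :=
  [:: b_main; b_cat; b_min; b_heads; b_rest; b_upto; b_from; b_gt; b_gt_at;
      b_meet; b_meet_at; b_imp; b_dianeg; b_dia; b_and1; b_and; b_negs; b_neg;
      b_nf; b_has; b_all].

(** * Correctness of the program *)

Section Correctness.
Context {d : Order.disp_t} {L : orderType d}.
Implicit Types (f g h : form L) (a b c : L) (A B C M R : seq L).

Definition olt : rel L := fun a c => (a < c)%O.
Notation "x =[ e ]=> y" := (run olt prog x e y) (at level 70).

Definition call i (x y : sexp L) : Prop := x =[ nth ENil prog i ]=> y.

Lemma run_eq x e y z : x =[ e ]=> y -> y = z -> x =[ e ]=> z.
Proof. by move=> h <-. Qed.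

Lemma run_ecall x i e y z : x =[ e ]=> y -> call i y z -> x =[ ECall i e ]=> z.
Proof. exact: run_call. Qed.

Fixpoint enclist (T : Type) (e : T -> sexp L) (s : seq T) : sexp L :=
  if s is x :: s' then Cons (e x) (enclist e s') else Nil.

Notation encw := (enclist (@Atom L)).
Notation encws := (enclist encw).
Definition encp (p : seq L * seq (seq L)) := Cons (encw p.1) (encws p.2).
Notation encd := (enclist encp).

Lemma tl_enclist T (e : T -> sexp L) s : tl (enclist e s) = enclist e (behead s).
Proof. by case: s. Qed.

Lemma is_nil_enclist T (e : T -> sexp L) s : is_nil (enclist e s) = nilp s.
Proof. by case: s. Qed.

Lemma is_nil_bool x : is_nil (of_bool L x) = ~~ x.
Proof. by case: x. Qed.

Ltac norm :=
  cbn [hd tl is_nil is_cons is_atom query enclist encp fst snd app cat negb];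
  rewrite ?tl_enclist ?is_nil_enclist ?is_nil_bool;
  repeat match goal with
  | H : ?x = true |- context [if ?x then _ else _] => rewrite H
  | H : ?x = false |- context [if ?x then _ else _] => rewrite H
  | H : ?x = true |- context [~~ ?x] => rewrite H
  | H : ?x = false |- context [~~ ?x] => rewrite H
  end; cbn [negb].

Create HintDb prog.

(** Symbolic execution: the expression selects the rule, [norm] settles tests from the context, and
    calls are closed by hypotheses or hints. The result is left open until [run_eq] compares it with
    the expected value. *)
Ltac go :=
  norm;
  lazymatch goal with
  | |- run _ _ _ EArg _ => apply: run_arg
  | |- run _ _ _ ENil _ => apply: run_nil
  | |- run _ _ _ ETrue _ => rewrite /ETrue; go
  | |- run _ _ _ EFst _ => rewrite /EFst; go
  | |- run _ _ _ ESnd _ => rewrite /ESnd; go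
  | |- run _ _ _ (ENot _) _ => rewrite /ENot; go
  | |- run _ _ _ (on_fst _) _ => rewrite /on_fst; go
  | |- run _ _ _ (on_snd _) _ => rewrite /on_snd; go
  | |- run _ _ _ (ECons _ _) _ => eapply run_cons; [go|go]
  | |- run _ _ _ (EHd _) _ => eapply run_hd; go
  | |- run _ _ _ (ETl _) _ => eapply run_tl; go
  | |- run _ _ _ (EOracle _ _) _ => eapply run_oracle; [go|go]
  | |- run _ _ _ (EIf _ _ _) _ => eapply run_if; [go|go]
  | |- run _ _ _ (ECall _ _) _ => eapply run_ecall; [go|go]
  | |- call _ _ _ => solve [eassumption | eauto with prog nocore]
  end.

Ltac exec b := eapply (@run_eq _ b); [unfold b; go|norm; try done].

Lemma call_cat T (e : T -> sexp L) s t :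
  call i_cat (Cons (enclist e s) (enclist e t)) (enclist e (s ++ t)).
Proof.
elim: s => [|x s IH]; exec b_cat.
Qed.
Hint Resolve call_cat : prog.

Fixpoint minw a A : L := if A is b :: A' then minw (if (b < a)%O then b else a) A' else a.

Lemma call_min a A : call i_min (encw (a :: A)) (Atom (minw a A)).
Proof.
elim: A a => [|b A IH] a; first by exec b_min.
have IHa := IH a; have IHb := IH b.
case E: (olt b a); move: (E); rewrite {1}/olt => /= ->; exec b_min.
Qed.

Lemma minw_min a A : minw a A \in a :: A /\ all (fun b => minw a A <= b)%O (a :: A).
Proof.
elim: A a => [|b A IH] a /=; first by rewrite mem_head lexx.
case: ltP => ab; [have [] := IH b|have [] := IH a] => /=.
  move=> h /andP[h1 h2]; rewrite inE h orbT h1 h2 !andbT; split=> //.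
  exact: le_trans h1 (ltW ab).
rewrite !inE => h /andP[h1 h2]; rewrite h1 h2 andbT (le_trans h1 ab); split=> //.
by case/orP: h => -> //; rewrite !orbT.
Qed.

(** If [c] is a lower bound of [A], this splits [A] at the first occurrence of [c]. *)
Definition heads c A : seq L := take (find (fun b => ~~ (c < b)%O) A) A.
Definition rest c A : seq L := drop (find (fun b => ~~ (c < b)%O) A) A.

Lemma heads_rest c A : heads c A ++ rest c A = A.
Proof. exact: cat_take_drop. Qed.

Lemma heads_all c A : all (fun b => c < b)%O (heads c A).
Proof. by rewrite /heads; elim: A => //= b A IH; case E: (c < b)%O => //=; rewrite E. Qed.

Lemma rest_tailof c A : all (fun b => c <= b)%O A -> tailof c (rest c A).
Proof.
rewrite /rest; elim: A => //= b A IH /andP[cb cA].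
by have [_|bc] := ltP c b; [exact: IH|rewrite /= cA eq_le bc cb].
Qed.

Lemma call_heads c A : call i_heads (Cons (Atom c) (encw A)) (encw (heads c A)).
Proof.
rewrite /heads; elim: A => [|b A IH] /=; first by exec b_heads.
case E: (olt c b); move: (E); rewrite {1}/olt => /= ->; exec b_heads.
Qed.

Lemma call_rest c A : call i_rest (Cons (Atom c) (encw A)) (encw (rest c A)).
Proof.
rewrite /rest; elim: A => [|b A IH] /=; first by exec b_rest.
case E: (olt c b); move: (E); rewrite {1}/olt => /= ->; exec b_rest.
Qed.

Lemma call_upto c A : call i_upto (Cons (Atom c) (encw A)) (encw (upto c A)).
Proof.
rewrite /upto; elim: A => [|b A IH] /=; first by exec b_upto.
case E: (olt b c); move: (E); rewrite {1}/olt => /= ->; exec b_upto.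
Qed.

Lemma call_from c A : call i_from (Cons (Atom c) (encw A)) (encw (from c A)).
Proof.
rewrite /from; elim: A => [|b A IH] /=; first by exec b_from.
case E: (olt b c); move: (E); rewrite {1}/olt => /= ->; exec b_from.
Qed.

Hint Resolve call_min call_heads call_rest call_upto call_from : prog.

(** All inner comparisons are shorter: each of the first two drops an occurrence of [c] from one
    worm, and the heads omit at least one letter because [c] occurs in [A ++ B]. *)
Lemma call_gt_at n c A B : c \in A ++ B -> all (fun b => c <= b)%O (A ++ B) ->
  size A + size B < n.+1 ->
  (forall A B, size A + size B < n -> exists x : bool,
    call i_gt (Cons (encw A) (encw B)) (of_bool L x) /\ cmp_spec A B x) ->
  exists x : bool, call i_gt_at (Cons (Atom c) (Cons (encw A) (encw B))) (of_bool L x) /\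
    cmp_spec A B x.
Proof.
rewrite all_cat ltnS => cAB /andP[cA cB] szn IH.
have tA := rest_tailof cA; have tB := rest_tailof cB.
have hA := heads_all c A; have hB := heads_all c B.
have eA := heads_rest c A; have eB := heads_rest c B.
have nAB : ~~ (nilp (rest c A) && nilp (rest c B)).
  apply/negP=> /andP[/nilP nA /nilP nB]; move: cAB; rewrite -eA -eB nA nB !cats0.
  by rewrite mem_cat => /orP[/(allP hA)|/(allP hB)]; rewrite ltxx.
have szA : size A = size (heads c A) + size (rest c A) by rewrite -size_cat eA.
have szB : size B = size (heads c B) + size (rest c B) by rewrite -size_cat eB.
have [x1 h1 s1] : exists2 x1, ~~ nilp (rest c A) ->
    call i_gt (Cons (encw B) (encw (behead (rest c A)))) (of_bool L x1) &
    ~~ nilp (rest c A) -> cmp_spec B (behead (rest c A)) x1.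
  (* With an empty tail no call takes place, and [true] is a placeholder. *)
  case nA: (nilp (rest c A)); first by exists true.
  have [|x [? ?]] := IH B (behead (rest c A)); last by exists x.
  by rewrite size_behead; move: nA szA; rewrite /nilp; lia.
have [x2 h2 s2] : exists2 x2, ~~ nilp (rest c B) ->
    call i_gt (Cons (encw A) (encw (behead (rest c B)))) (of_bool L x2) &
    ~~ nilp (rest c B) -> cmp_spec A (behead (rest c B)) x2.
  case nB: (nilp (rest c B)); first by exists true.
  have [|x [? ?]] := IH A (behead (rest c B)); last by exists x.
  by rewrite size_behead; move: nB szB; rewrite /nilp; lia.
have [|x3 [h3 s3]] := IH (heads c A) (heads c B).
  by move: nAB; rewrite /nilp; lia.
exists ((~~ nilp (rest c A) && ~~ x1) || ((nilp (rest c B) || x2) && x3)).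
split; last first.
  by have := cmp_step hA hB tA tB nAB _ _ s3; rewrite eA eB; apply.
move: h1 h2 h3 {s1 s2 s3 szA szB nAB}.
case nA: (nilp (rest c A)); case nB: (nilp (rest c B)) => /=.
- move=> _ _ h3; exec b_gt_at.
- move=> _ /(_ isT) h2 h3; move: h2; case E2: x2 => h2; exec b_gt_at.
- move=> /(_ isT) h1 _ h3; move: h1; case E1: x1 => h1; exec b_gt_at.
- move=> /(_ isT) h1 /(_ isT) h2 h3; move: h1 h2.
  case E1: x1; case E2: x2 => h1 h2; exec b_gt_at.
Qed.

Lemma call_gt A B : exists x : bool,
  call i_gt (Cons (encw A) (encw B)) (of_bool L x) /\ cmp_spec A B x.
Proof.
have [n] := ubnP (size A + size B); elim: n A B => // n IH [|a A] B sz.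
  by exists false; split; [exec b_gt|exact: cmp_nil].
have [c_in c_min] := minw_min a (A ++ B); have hmin := call_min a (A ++ B).
have hcat := call_cat (@Atom L) (a :: A) B.
have [x [hx sx]] := @call_gt_at n _ (a :: A) B c_in c_min sz IH.
by exists x; split=> //; exec b_gt.
Qed.

Lemma call_meet_at n c A B : c \in A ++ B -> all (fun b => c <= b)%O (A ++ B) ->
  size A + size B < n.+1 ->
  (forall A B, size A + size B < n -> exists M,
    call i_meet (Cons (encw A) (encw B)) (encw M) /\ meet_spec A B M) ->
  exists M, call i_meet_at (Cons (Atom c) (Cons (encw A) (encw B))) (encw M) /\
    meet_spec A B M.
Proof.
rewrite all_cat ltnS => cAB /andP[cA cB] szn IH.
have tA := rest_tailof cA; have tB := rest_tailof cB.
have hA := heads_all c A; have hB := heads_all c B.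
have eA := heads_rest c A; have eB := heads_rest c B.
have [|M [hM sM]] := IH (heads c A) (heads c B).
  have szA : size A = size (heads c A) + size (rest c A) by rewrite -size_cat eA.
  have szB : size B = size (heads c B) + size (rest c B) by rewrite -size_cat eB.
  suff: size (rest c A) + size (rest c B) != 0 by lia.
  apply/negP; rewrite addn_eq0 !size_eq0 => /andP[/eqP nA /eqP nB]; move: cAB.
  rewrite -eA -eB nA nB !cats0.
  by rewrite mem_cat => /orP[/(allP hA)|/(allP hB)]; rewrite ltxx.
have [x [hx sx]] := call_gt (behead (rest c B)) (behead (rest c A)).
have := meet_step hA hB tA tB sM (fun _ _ => sx); rewrite eA eB.
set M' := M ++ _ => sM'; exists M'; split=> //; move: @M' {sM' IH}.
case nA: (nilp (rest c A)); first by move=> M'; exec b_meet_at.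
case nB: (nilp (rest c B)); first by move=> M'; exec b_meet_at.
by move: hx; case E: x => hx M'; exec b_meet_at.
Qed.

Lemma call_meet A B : exists M,
  call i_meet (Cons (encw A) (encw B)) (encw M) /\ meet_spec A B M.
Proof.
have [n] := ubnP (size A + size B); elim: n A B => // n IH [|a A] B sz.
  by exists B; split; [exec b_meet|exact: meet_nil].
have [c_in c_min] := minw_min a (A ++ B); have hmin := call_min a (A ++ B).
have hcat := call_cat (@Atom L) (a :: A) B.
have [M [hM sM]] := @call_meet_at n _ (a :: A) B c_in c_min sz IH.
by exists M; split=> //; exec b_meet.
Qed.

Lemma call_imp A B : exists x : bool,
  call i_imp (Cons (encw A) (encw B)) (of_bool L x) /\ imp_spec A B x.
Proof.
have [M [hM sM]] := call_meet A B; have [x [hx sx]] := call_gt M A.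
exists (~~ x); split; last exact: imp_step sx.
by move: hx {sx}; case E: x => hx; exec b_imp.
Qed.

Lemma call_dianeg c A Bs : exists Cs,
  call i_dianeg (Cons (Atom c) (Cons (encw A) (encws Bs))) (encws Cs) /\ dianeg c A Bs Cs.
Proof.
elim: Bs => [|B Bs [Cs [hCs sCs]]].
  by exists [::]; split; [exec b_dianeg|exact: dianeg_nil].
have [x [hx sx]] := call_imp A (upto c B).
exists (if x then from c B :: Cs else Cs); split; last exact: dianeg_cons.
by move: hx {sx}; case E: x => hx; exec b_dianeg.
Qed.

Definition Or f g : form L := Neg (And (Neg f) (Neg g)).

Lemma dia_or c f g : eqv (Dia c (Or f g)) (Or (Dia c f) (Dia c g)).
Proof.
have h1 : ent (Box c (Neg f)) (Box c (Imp (Neg g) (Neg (Or f g)))).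
  by apply: ent_box; apply: GLP_taut; ptaut.
have h2 : ent (Dia c f) (Dia c (Or f g)) by apply: ent_dia; apply: GLP_taut; ptaut.
have h3 : ent (Dia c g) (Dia c (Or f g)) by apply: ent_dia; apply: GLP_taut; ptaut.
split; first by apply: (GLP_tc2 h1 (GLP_K c (Neg g) (Neg (Or f g)))); ptaut.
by apply: (GLP_tc2 h2 h3); ptaut.
Qed.

Lemma eqv_refl f : eqv f f.
Proof. by split; exact: ent_refl. Qed.

Lemma eqv_trans g f h : eqv f g -> eqv g h -> eqv f h.
Proof. by move=> [h1 h2] [h3 h4]; split; [exact: ent_trans h3|exact: ent_trans h2]. Qed.

Lemma eqv_taut f g : (forall v, peval v f = peval v g) -> eqv f g.
Proof. by move=> h; split; apply: GLP_taut => v /=; rewrite h; case: (peval v g). Qed.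

Lemma eqv_neg f g : eqv f g -> eqv (Neg f) (Neg g).
Proof. by move=> [h1 h2]; split; [apply: (GLP_tc1 h2)|apply: (GLP_tc1 h1)]; ptaut. Qed.

Lemma eqv_and f f' g g' : eqv f f' -> eqv g g' -> eqv (And f g) (And f' g').
Proof.
by move=> [h1 h2] [h3 h4]; split; [apply: (GLP_tc2 h1 h3)|apply: (GLP_tc2 h2 h4)]; ptaut.
Qed.

Lemma eqv_or f f' g g' : eqv f f' -> eqv g g' -> eqv (Or f g) (Or f' g').
Proof. by move=> h1 h2; apply/eqv_neg/eqv_and; apply: eqv_neg. Qed.

Lemma eqv_dia c f g : eqv f g -> eqv (Dia c f) (Dia c g).
Proof. by move=> [h1 h2]; split; apply: ent_dia. Qed.

Lemma dnf_cons p D : dnf (p :: D) = Or (conj p) (dnf D).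
Proof. by []. Qed.

Lemma dnf_cat D E : eqv (dnf (D ++ E)) (Or (dnf D) (dnf E)).
Proof.
elim: D => [|p D IH]; first by apply: eqv_taut; ptaut.
rewrite cat_cons !dnf_cons; apply: eqv_trans (eqv_or (eqv_refl _) IH) _.
by apply: eqv_taut; ptaut.
Qed.

Lemma call_dia c D : exists E,
  call i_dia (Cons (Atom c) (encd D)) (encd E) /\ eqv (dnf E) (Dia c (dnf D)).
Proof.
elim: D => [|[A Bs] D [E [hE sE]]].
  exists [::]; split; first by exec b_dia.
  have h : GLP (Box c (Neg (Neg (@Top L)))) by apply/GLP_nec/GLP_taut; ptaut.
  by split; apply: (GLP_tc1 h); ptaut.
have [Cs [hCs [h1 h2]]] : exists Cs, call i_dianeg
    (Cons (Atom c) (Cons (encw (upto c A)) (encws Bs))) (encws Cs) /\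
    eqv (Dia c (conj (A, Bs))) (conj (c :: A, Cs)).
  have [Cs [hCs sCs]] := call_dianeg c (upto c A) Bs.
  by exists Cs; split=> //; exact: conj_dia.
exists ((c :: A, Cs) :: E); split; first by exec b_dia.
rewrite !dnf_cons; have [h3 h4] := dia_or c (conj (A, Bs)) (dnf D).
by apply: (@eqv_trans (Or (Dia c (conj (A, Bs))) (Dia c (dnf D)))) => //; apply: eqv_or.
Qed.

Lemma negs_cat (Bs Cs : seq (seq L)) v :
  peval v (negs (Bs ++ Cs)) = peval v (negs Bs) && peval v (negs Cs).
Proof. by elim: Bs => //= B Bs ->; rewrite andbA. Qed.

Lemma call_and1 p E : exists F,
  call i_and1 (Cons (encp p) (encd E)) (encd F) /\ eqv (dnf F) (And (conj p) (dnf E)).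
Proof.
case: p => A Bs; elim: E => [|[A' Bs'] E [F [hF sF]]].
  by exists [::]; split; [exec b_and1|apply: eqv_taut; ptaut].
have [M [hM [sM _]]] := call_meet A A'.
exists ((M, Bs ++ Bs') :: F); split; first by exec b_and1.
have h : eqv (conj (M, Bs ++ Bs')) (And (conj (A, Bs)) (conj (A', Bs'))).
  apply: (@eqv_trans (And (And (worm A) (worm A')) (negs (Bs ++ Bs')))).
    by apply: eqv_and => //; exact: eqv_refl.
  by apply: eqv_taut => v /=; rewrite negs_cat; move: v; ptaut.
rewrite !dnf_cons; apply: eqv_trans (eqv_or h sF) _.
by apply: eqv_taut; ptaut.
Qed.

Lemma call_and D E : exists F,
  call i_and (Cons (encd D) (encd E)) (encd F) /\ eqv (dnf F) (And (dnf D) (dnf E)).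
Proof.
elim: D => [|p D [F [hF sF]]].
  by exists [::]; split; [exec b_and|apply: eqv_taut => v /=].
have [G [hG sG]] := call_and1 p E.
exists (G ++ F); split; first by exec b_and.
apply: eqv_trans (dnf_cat _ _) _; apply: eqv_trans (eqv_or sG sF) _.
by apply: eqv_taut; ptaut.
Qed.

Lemma call_negs Bs : exists D,
  call i_negs (encws Bs) (encd D) /\ eqv (dnf D) (Neg (negs Bs)).
Proof.
elim: Bs => [|B Bs [D [hD sD]]].
  by exists [::]; split; [exec b_negs|apply: eqv_taut].
exists ((B, [::]) :: D); split; first by exec b_negs.
rewrite dnf_cons; apply: eqv_trans (eqv_or (eqv_refl _) sD) _.
by apply: eqv_taut; ptaut.
Qed.

(** De Morgan: negating [(A, Bs)] gives the disjunct [([::], [:: A])] and one disjunct for each worm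
    in [Bs]. The pair [([::], [::])] is truth. *)
Lemma call_neg D : exists E,
  call i_neg (encd D) (encd E) /\ eqv (dnf E) (Neg (dnf D)).
Proof.
elim: D => [|[A Bs] D [E [hE sE]]].
  by exists [:: ([::], [::])]; split; [exec b_neg|apply: eqv_taut].
have [D1 [hD1 sD1]] := call_negs Bs.
have [F [hF sF]] := call_and (([::], [:: A]) :: D1) E.
exists F; split; first by exec b_neg.
apply: eqv_trans sF _; rewrite !dnf_cons.
apply: eqv_trans (eqv_and (eqv_or (eqv_refl _) sD1) sE) _.
by apply: eqv_taut; ptaut.
Qed.

(** The numeral tag is read off by testing successive tails. Boxes are treated as [[c]f =
    ~<c>~f]. *)
Lemma call_nf f : closed_form f -> exists D,
  call i_nf (encode f) (encd D) /\ eqv (dnf D) f.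
Proof.
elim: f => [n||f IH|f IHf g IHg|c f IH] //=.
- move=> _; exists [:: ([::], [::])]; split; first by exec b_nf.
  exact: eqv_taut.
- move=> /IH[D [hD sD]]; have [E [hE sE]] := call_neg D.
  exists E; split; first by exec b_nf.
  by apply: eqv_trans sE (eqv_neg _).
- move=> /andP[/IHf[D [hD sD]] /IHg[E [hE sE]]]; have [F [hF sF]] := call_and D E.
  exists F; split; first by exec b_nf.
  by apply: eqv_trans sF (eqv_and _ _).
- move=> /IH[D [hD sD]]; have [E [hE sE]] := call_neg D.
  have [F [hF sF]] := call_dia c E; have [G [hG sG]] := call_neg F.
  exists G; split; first by exec b_nf.
  apply: eqv_trans sG _.
  apply: (@eqv_trans (Neg (Dia c (Neg f)))).
    by apply/eqv_neg; apply: eqv_trans sF _; apply/eqv_dia;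
      apply: eqv_trans sE (eqv_neg _).
  have h1 : ent (Box c (Neg (Neg f))) (Box c f) by apply: ent_box; apply: GLP_taut; ptaut.
  have h2 : ent (Box c f) (Box c (Neg (Neg f))) by apply: ent_box; apply: GLP_taut; ptaut.
  by split; [apply: (GLP_tc1 h1)|apply: (GLP_tc1 h2)]; ptaut.
Qed.

Lemma call_has A Bs : exists x : bool,
  call i_has (Cons (encw A) (encws Bs)) (of_bool L x) /\
  if x then exists2 B, B \in Bs & imp_spec A B true
  else forall B, B \in Bs -> imp_spec A B false.
Proof.
elim: Bs => [|B Bs [x [hx sx]]]; first by exists false; split; [exec b_has|].
have [y [hy sy]] := call_imp A B; case: y hy sy => hy sy.
  exists true; split; first by exec b_has.
  by exists B => //; rewrite mem_head.
exists x; split; first by exec b_has.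
case: x sx {hx} => [[C CBs sC]|h]; first by exists C => //; rewrite inE CBs orbT.
by move=> C; rewrite inE => /orP[/eqP ->|/h].
Qed.

(** A disjunction is refutable when all its disjuncts are, and [call_has] decides each of them. *)
Lemma call_all D : exists x : bool,
  call i_all (encd D) (of_bool L x) /\ (x <-> GLP (Neg (dnf D))).
Proof.
elim: D => [|[A Bs] D [x [hx sx]]].
  exists true; split; first by exec b_all.
  by split=> // _; apply: GLP_taut.
have [y [hy sy]] := call_has A Bs; exists (y && x); split.
  by case: y hy {sy} => hy; exec b_all.
rewrite dnf_cons; case: y {hy} sy => [[B BBs hB]|h] /=.
  have h := conj_inconsistent BBs hB; apply: iff_trans sx _; split=> h1.
    by apply: (GLP_tc2 h h1); ptaut.
  by apply: (GLP_tc1 h1); ptaut.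
split=> // h1; case: (conj_consistent h).
by apply: (GLP_tc1 h1); ptaut.
Qed.

(** Provability of [f] is refutability of the normal form of its negation. *)
Lemma call_main f : closed_form f -> exists x : bool,
  computes olt prog (encode f) (of_bool L x) /\ (x <-> GLP f).
Proof.
move=> /call_nf[D [hD sD]]; have [E [hE sE]] := call_neg D.
have [x [hx sx]] := call_all E; exists x; split.
  by rewrite /computes; exec b_main.
apply: iff_trans sx _; have [h1 h2] := eqv_trans sE (eqv_neg sD).
by split=> h; [apply: (GLP_tc2 h2 h)|apply: (GLP_tc2 h1 h)]; ptaut.
Qed.

End Correctness.

Theorem mainTheorem3 (d : Order.disp_t) (L : orderType d) :
  exists P : program,
    effectively_decides P (fun f : form L => closed_form f) (@GLP0 d L).
Proof.
exists prog => f cf; have [x [hx sx]] := call_main cf; exists x; split=> //.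
by rewrite sx; split=> [|[]].
Qed.
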